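(* Let $\ell_1,\ell_2,\dots,\ell_m$ be positive integers, let $\mathcal{U}=\bigcup_{i=1}^m\{(i,j)\in\mathbb{Z}_{\ge1}^2 : j=1,2,\dots,\ell_i\}$, and let $f_{i,j}(x)$ $((i,j)\in\mathcal{U})$ be integer-valued polynomials of degree $\ge 2$ with positive leading coefficients such that $f_{i_1,j_1}\sim f_{i_2,j_2}$ whenever $i_1=i_2$ and $f_{i_1,j_1}\not\sim f_{i_2,j_2}$ whenever $i_1\neq i_2$. For each $i=1,2,\dots,m$, let $g_i(x)$ be a polynomial for which there exist integers $B_{i,j}>0$, $C_{i,j}$, $D_{i,j}$ $(j=1,2,\dots,\ell_i)$ with $$g_i(x)\equiv f_{i,j}\!\left(\frac{x+C_{i,j}}{B_{i,j}}\right)+D_{i,j}\qquad (j=1,2,\dots,\ell_i)$$ (such $g_i$ always exist). Let $q$ be a Pisot or Salem number and let $P_{i,j}(x)$ $((i,j)\in\mathcal{U})$ be non-zero polynomials with algebraic integer coefficients in $\mathbb{Q}(q)$. For $(i,j)\in\mathcal{U}$ and integers $n\ge 0$ define $$\tilde p_{i,j}(n)=\begin{cases}P_{i,j}\!\left(\frac{n+C_{i,j}}{B_{i,j}}\right) & \text{if } n\equiv -C_{i,j}\pmod{B_{i,j}},\\ 0 & \text{otherwise.}\end{cases}$$ Then the numbers $$1,\qquad \sum_{n=1}^{\infty}\frac{P_{i,j}(n)}{q^{f_{i,j}(n)}}\quad ((i,j)\in\mathcal{U})$$ are linearly independent over $\mathbb{Q}(q)$ if and only if, for each $i=1,2,\dots,m$,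 the sequences $\{\tilde p_{i,j}(n)\}_{n\ge0}$ $(j=1,2,\dots,\ell_i)$ are linearly independent over $\mathbb{Q}(q)$.
   Context: A Pisot number (resp. Salem number) is a real algebraic integer greater than $1$ all of whose Galois conjugates other than itself have absolute value less than $1$ (resp. less than or equal to $1$, with at least one conjugate of absolute value exactly $1$). A polynomial $f(x)$ is integer-valued if $f(n)\in\mathbb{Z}$ for every positive integer $n$. $F(x)\equiv G(x)$ means identical equality of polynomials. For polynomials $F,G$ with rational coefficients, $F\sim G$ means there exist rational numbers $b>0$, $c$ and an integer $d$ with $F(x)\equiv G(bx+c)+d$; $F\not\sim G$ otherwise (this is an equivalence relation). Sequences $\{b_j(n)\}_{n\ge0}$ $(j=1,\dots,\ell)$ of complex numbers are linearly dependent over $\mathbb{Q}(q)$ if there exist $k_1,\dots,k_\ell\in\mathbb{Q}(q)$, not all zero, with $\sum_{j=1}^\ell k_j b_j(n)=0$ for every integer $n\ge0$; otherwise they are linearly independent over $\mathbb{Q}(q)$. *)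

(* Defs.v *)
From HB Require Import structures.
From mathcomp Require Import all_boot all_order all_algebra.
From mathcomp Require Import complex.
From mathcomp Require Import all_classical all_reals all_analysis.

Set Implicit Arguments.
Unset Strict Implicit.
Unset Printing Implicit Defensive.

Import Order.TTheory GRing.Theory Num.Theory.
Import numFieldNormedType.Exports.

Local Open Scope ring_scope.

Definition algebraic_integer (R : realType) (x : R) : Prop :=
  integralOver (intr : int -> R) x.

(* p is the minimal polynomial of x over Q up to a scalar, so x is one of its
   own conjugates. *)
Definition galois_conjugate (R : realType) (x : R) (z : R[i]) : Prop :=
  exists p : {poly rat}, [/\ irreducible_poly p,
    root (map_poly (ratr : rat -> R) p) x &
    root (map_poly (ratr : rat -> R[i]) p) z].

Definition pisot (R : realType) (q : R) : Prop :=
  [/\ algebraic_integer q, 1 < q &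
    forall z : R[i], galois_conjugate q z -> z != q%:C%C -> `|z| < 1].

Definition salem (R : realType) (q : R) : Prop :=
  [/\ algebraic_integer q, 1 < q,
    forall z : R[i], galois_conjugate q z -> z != q%:C%C -> `|z| <= 1 &
    exists2 z : R[i], galois_conjugate q z & `|z| = 1].

Definition in_Qadjoin (R : realType) (q x : R) : Prop :=
  exists a b : {poly rat}, (map_poly ratr b).[q] != 0 /\
    x = (map_poly ratr a).[q] / (map_poly ratr b).[q].

Definition linearly_dependent (R : realType) (q : R) (I : finType)
    (x : I -> R) : Prop :=
  exists k : I -> R, [/\ forall i, in_Qadjoin q (k i),
    exists i, k i != 0 & \sum_i k i * x i = 0].

Definition linearly_independent (R : realType) (q : R) (I : finType)
    (x : I -> R) : Prop := ~ linearly_dependent q x.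

Definition seq_linearly_dependent (R : realType) (q : R) (I : finType)
    (b : I -> nat -> R) : Prop :=
  exists k : I -> R, [/\ forall i, in_Qadjoin q (k i),
    exists i, k i != 0 & forall n, \sum_i k i * b i n = 0].

Definition seq_linearly_independent (R : realType) (q : R) (I : finType)
    (b : I -> nat -> R) : Prop := ~ seq_linearly_dependent q b.

Definition integer_valued (f : {poly rat}) : Prop :=
  forall n : nat, (0 < n)%N -> f.[n%:R] \is a Num.int.

Definition poly_sim (F G : {poly rat}) : Prop :=
  exists (b c : rat) (d : int), 0 < b /\
    F = G \Po (b *: 'X + c%:P) + (d%:~R)%:P.

Definition common_form (n : nat) (f : 'I_n -> {poly rat}) (g : {poly rat})
    (B C D : 'I_n -> int) : Prop :=
  forall j, 0 < B j /\
    g = f j \Po ((B j)%:~R^-1 *: ('X + ((C j)%:~R)%:P)) + ((D j)%:~R)%:P.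

Definition ptilde (R : realType) (P : {poly R}) (B C : int) (n : nat) : R :=
  if (n%:Z == - C %[mod B])%Z then P.[(n%:Z + C)%:~R / B%:~R] else 0.

(* The exponent f(n) is an integer when f is integer-valued, possibly negative
   for small n. *)
Definition qseries (R : realType) (q : R) (P : {poly R}) (f : {poly rat}) : R :=
  \big[+%R/0]_(1 <= n <oo) (P.[n%:R] / q `^ ratr f.[n%:R]).

(* Main.v *)
Require Import Defs.
From HB Require Import structures.
From mathcomp Require Import all_boot all_order all_algebra.
From mathcomp Require Import complex.
From mathcomp Require Import all_classical all_reals all_analysis.
From mathcomp Require Import ring lra zify.
From mathcomp Require separable fieldext.

(** Collecting equal exponents turns a linear relation between the numbers into
    [sum_k b_k / q^k = 0], where [b_k] lies in [Z[q]] (after clearing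
    denominators) and all its conjugates grow polynomially in [k].  If [b_k]
    vanishes on a window after [E] that is longer than a multiple of [log E],
    then [q^E * sum_(k <= E) b_k / q^k] is exponentially small while its other
    conjugates grow polynomially, because the conjugates of [q] lie in the closed
    unit disc; its norm is an integer of absolute value [< 1], so it is [0].
    Hence [b_e = 0] whenever the exponent [e] is isolated.

    Isolated exponents [g_i(x)] exist when [g_i] has minimal degree among the
    classes that occur: if both [x] and [x + t] match values [g_j(y)], [g_j(y')]
    up to [sqrt x], then for large [x] both degrees equal some [d], and
    [y' - y = b t] where [b^d] is the ratio of the leading coefficients; so [b] is
    rational, and [g_i], [g_j] are similar.  So matches with one [g_j] are further and further apart, and a
    pigeonhole argument leaves an unmatched [x] where the combination of the
    [ptilde] does not vanish. *)

Set Implicit Arguments.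
Unset Strict Implicit.
Unset Printing Implicit Defensive.

Import Order.TTheory GRing.Theory Num.Theory.
Import numFieldNormedType.Exports.

Local Open Scope ring_scope.

(** The window around x, of length about the square root of x, is squeezed from both sides. Its
    power of [q] must beat every fixed power of the exponent, which is polynomial in x; and it must
    stay below the gaps between values of one [g_i], which are at least of order x because the
    degree is at least 2. The second bound keeps a class from disturbing itself, so only matches
    with other classes have to be excluded. A match must also differ by an integer, since similarity
    allows only integer shifts. The pigeonhole needs the combination of the [ptilde] to be nonzero
    at many equally spaced points. Along a progression whose step is divisible by every [B] of the
    class it is a polynomial in the index, hence nonzero from some point on; among m + 1 such points
    two would be matched by the same class. The other implication: a relation between the [ptilde]
    of one class kills every coefficient of large exponent, so the same combination of the series is
    a finite sum in Q(q), which the number 1 absorbs. *)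

Lemma archi_nat_ge (R : archiRealFieldType) (x : R) : exists n : nat, x <= n%:R.
Proof. by exists (Num.truncn x).+1; rewrite ltW// truncnS_gt. Qed.

Lemma map_ratr_intr (K : numFieldType) (s : {poly int}) :
  map_poly (ratr : rat -> K) (map_poly intr s) = map_poly intr s.
Proof. by rewrite -map_poly_comp; apply: eq_map_poly => x /=; rewrite ratr_int. Qed.

Lemma horner_ratr_nat (K : numFieldType) (p : {poly rat}) (n : nat) :
  (map_poly ratr p).[n%:R] = ratr p.[n%:R] :> K.
Proof. by rewrite -horner_map rmorph_nat. Qed.

Lemma dist_ratr_nat (K : numFieldType) (p1 p2 : {poly rat}) (n1 n2 w : nat) :
  `|p1.[n1%:R] - p2.[n2%:R]| <= w%:R ->
  `|(map_poly ratr p1).[n1%:R] - (map_poly ratr p2).[n2%:R]| <= w%:R :> K.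
Proof. by rewrite !horner_ratr_nat -rmorphB -ratr_norm -(ratr_nat K w) ler_rat. Qed.

(** * Polynomial asymptotics *)

Section PolynomialAsymptotics.
Variable R : realFieldType.
Implicit Types (p : {poly R}) (u v h : R).

Lemma poly_bound_ge1 p : exists2 A, 0 < A &
  forall n u, (size p <= n.+1)%N -> 1 <= u -> `|p.[u]| <= A * u ^+ n.
Proof.
exists (1 + \sum_(i < size p) `|p`_i|); first by rewrite ltr_pwDl ?sumr_ge0.
move=> n u sp u1; have u0 : 0 <= u by apply: le_trans u1.
rewrite horner_coef (le_trans (ler_norm_sum _ _ _))//.
rewrite mulrDl mul1r ler_wpDl ?exprn_ge0// mulr_suml ler_sum// => i _.
rewrite normrM normrX (ger0_norm u0) ler_wpM2l// ler_weXn2l//.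
by have := ltn_ord i; lia.
Qed.

Lemma poly_sub_lead p d : size p = d.+2 -> exists2 A, 0 < A &
  forall u, 1 <= u -> `|p.[u] - lead_coef p * u ^+ d.+1| <= A * u ^+ d.
Proof.
move=> sp; pose r := p - lead_coef p *: 'X^(d.+1).
have sr : (size r <= d.+1)%N.
  apply/leq_sizeP => j; rewrite leq_eqVlt => /predU1P[<-|dj].
    by rewrite !coefE lead_coefE sp eqxx mulr1 subrr.
  rewrite !coefE nth_default ?sp// gtn_eqF// mulr0.
  by rewrite subrr.
have [A A0 HA] := poly_bound_ge1 r; exists A => // u u1.
by have := HA d u sr u1; rewrite /r !hornerE.
Qed.

Lemma poly_lower p d : size p = d.+1 -> 0 < lead_coef p ->
  exists2 U, 1 <= U & forall u, U <= u -> lead_coef p / 2 * u ^+ d <= p.[u].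
Proof.
case: d => [|d] sp lp.
  exists 1 => // u _; rewrite expr0 mulr1.
  have /size_poly1P[c c0 pE] : size p == 1 by rewrite sp.
  by move: lp; rewrite pE lead_coefC hornerC; lra.
have [A A0 HA] := poly_sub_lead sp.
exists (1 + 2 * A / lead_coef p).
  by rewrite lerDl divr_ge0 ?mulr_ge0 ?ltW.
move=> u uU; have u1 : 1 <= u.
  by apply: le_trans uU; rewrite lerDl divr_ge0 ?mulr_ge0 ?ltW.
have /ler_normlP[+ _] := HA u u1; rewrite opprB.
set a := lead_coef p in lp uU *.
have H : 2 * A <= a * u.
  by rewrite [a * u]mulrC -ler_pdivrMr// (le_trans _ uU)// lerDr.
have u0 : 0 <= u ^+ d by rewrite exprn_ge0// (le_trans _ u1).
have : 2 * A * u ^+ d <= a * u * u ^+ d by rewrite ler_wpM2r.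
rewrite exprS; move: (u ^+ d) u0 => U u0; nra.
Qed.

Lemma poly_abs_lower p d : size p = d.+1 ->
  exists2 c, 0 < c & exists2 U, 1 <= U & forall u, U <= u -> c * u ^+ d <= `|p.[u]|.
Proof.
move=> sp; have lp : lead_coef p != 0 by rewrite lead_coef_eq0 -size_poly_eq0 sp.
wlog lp0 : p sp lp / 0 < lead_coef p.
  move=> W; move: (lp); rewrite neq_lt => /orP[l0|l0]; last first.
    by apply: W.
  have [|||c c0 [U U1 H]] := W (- p); rewrite ?size_polyN ?lead_coefN ?oppr_eq0 ?oppr_gt0//.
  exists c => //; exists U => // u uU.
  by have := H u uU; rewrite hornerN normrN.
have [U U1 HU] := poly_lower sp lp0.
exists (lead_coef p / 2); first by rewrite divr_gt0.
exists U => // u uU; exact: le_trans (HU _ uU) (ler_norm _).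
Qed.

Lemma coef_nderivn_top p d i : size p = d.+1 -> (i <= d)%N ->
  size p^`N(i) = (d - i).+1 /\ lead_coef p^`N(i) = lead_coef p *+ 'C(d, i).
Proof.
move=> sp id.
have pd : p`_d != 0.
  have : lead_coef p != 0 by rewrite lead_coef_eq0 -size_poly_eq0 sp.
  by rewrite lead_coefE sp.
have nz : p^`N(i)`_(d - i) != 0.
  rewrite coef_nderivn subnKC// mulrn_eq0 negb_or pd andbT -lt0n bin_gt0//.
have szi : size p^`N(i) = (d - i).+1.
  apply/eqP; rewrite eqn_leq; apply/andP; split.
    apply/leq_sizeP => j hj; rewrite coef_nderivn nth_default ?mul0rn// sp.
    by lia.
  by rewrite ltnNge; apply: contra nz => h; rewrite nth_default.
by split => //; rewrite !lead_coefE szi sp /= coef_nderivn subnKC.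
Qed.

(** In the Taylor expansion at [v] every divided derivative has positive leading coefficient, so
    past a common threshold all of them are nonnegative and the first-order term alone is a lower
    bound, for increments of any length. *)
Lemma poly_increment p d : size p = d.+2 -> 0 < lead_coef p ->
  exists2 c, 0 < c & exists2 U, 1 <= U &
  forall u v, U <= v -> v <= u -> c * (u - v) * v ^+ d <= p.[u] - p.[v].
Proof.
move=> sp lp.
have H (i : 'I_d.+2) : exists U : R, 1 <= U /\ forall u, U <= u ->
    lead_coef p / 2 * u ^+ (d.+1 - i) <= p^`N(i).[u].
  have [si li] := coef_nderivn_top sp (ltn_ord i : i <= d.+1)%N.
  have li0 : 0 < lead_coef p^`N(i).
    by rewrite li pmulrn_lgt0 ?bin_gt0// -ltnS.
  have [U U1 HU] := poly_lower si li0; exists U; split => // u uU.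
  apply: le_trans (HU u uU); apply: ler_wpM2r.
    by rewrite exprn_ge0// (le_trans _ uU)// (le_trans _ U1).
  rewrite ler_pM2r ?invr_gt0// li -mulr_natr.
  by apply: ler_peMr; [exact: ltW | rewrite ler1n bin_gt0 -ltnS].
have [U HU] := choice H.
exists (lead_coef p / 2); first by rewrite divr_gt0.
exists (1 + \sum_i U i); first by rewrite lerDl sumr_ge0// => i _; rewrite (le_trans _ (HU i).1).
move=> u v vU vu.
have Hv i : U i <= v.
  apply: le_trans vU; rewrite (bigD1 i)//= addrCA lerDl addr_ge0// sumr_ge0// => j _.
  by rewrite (le_trans _ (HU j).1).
have v0 : 0 <= v by rewrite (le_trans _ (Hv 0))// (le_trans _ (HU 0).1).
rewrite -{2}[u](subrK v) (addrC _ v) nderiv_taylor; last exact: mulrC.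
rewrite sp big_ord_recl /= nderivn0 expr0 mulr1 (addrC p.[v]) addrK.
rewrite big_ord_recl /= expr1.
have := (HU (lift ord0 ord0)).2 v (Hv _); rewrite /= /bump /= subSS subn0 => H1.
have uv : 0 <= u - v by rewrite subr_ge0.
rewrite mulrAC ler_wpDr//; last by rewrite ler_wpM2r.
apply: sumr_ge0 => i _; rewrite mulr_ge0 ?exprn_ge0//.
have := (HU (lift ord0 (lift ord0 i))).2 v (Hv _); apply: le_trans.
by rewrite mulr_ge0 ?exprn_ge0// divr_ge0// ltW.
Qed.

(** Taylor expansion for a bounded step: replacing the first derivative by its leading monomial, and
    dropping the higher terms, both cost only order [v ^+ d], two degrees below [p]. *)
Lemma poly_first_order p d M : size p = d.+3 -> exists2 A, 0 < A &
  forall v h, 1 <= v -> `|h| <= M ->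
  `|p.[v + h] - p.[v] - lead_coef p * d.+2%:R * h * v ^+ d.+1| <= A * v ^+ d.
Proof.
move=> sp.
have H (i : 'I_d.+3) : exists A : R, 0 < A /\ forall n u, (size p^`N(i) <= n.+1)%N ->
     1 <= u -> `|p^`N(i).[u]| <= A * u ^+ n.
  by have [A A0 HA] := poly_bound_ge1 p^`N(i); exists A.
have [A HA] := choice H.
have [s1 l1] := coef_nderivn_top sp (isT : 1 <= d.+2)%N.
rewrite subSS subn0 in s1.
have [A1 A10 HA1] := poly_sub_lead s1.
have Ms (i : nat) h : `|h| <= M -> `|h| ^+ i <= M ^+ i.
  by move=> hM; rewrite lerXn2r// nnegrE// (le_trans _ hM).
exists (1 + A1 * `|M| + \sum_i A i * `|M| ^+ i).
  rewrite ltr_pwDl// ?sumr_ge0// => [|i _]; last by rewrite mulr_ge0 ?exprn_ge0// ltW// (HA i).1.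
  by rewrite ltr_pwDl// mulr_ge0// ltW.
move=> v h v1 hM; rewrite nderiv_taylor; last exact: mulrC.
have M0 : 0 <= M by rewrite (le_trans _ hM).
have v0 : 0 <= v by rewrite (le_trans _ v1).
rewrite sp big_ord_recl /= nderivn0 expr0 mulr1 (addrC p.[v]) addrK.
rewrite big_ord_recl /= expr1 /bump /= add1n.
rewrite [X in `|X|](_ : _ = h * (p^`N(1).[v] - lead_coef p^`N(1) * v ^+ d.+1) +
   \sum_(i < d.+1) p^`N((bump 0 (bump 0 i))).[v] * h ^+ (bump 0 (bump 0 i))); last first.
  by rewrite l1 bin1 -mulr_natr; ring.
rewrite (le_trans (ler_normD _ _))// !mulrDl mul1r -addrA ler_wpDl ?exprn_ge0//.
apply: lerD.
  rewrite normrM mulrC mulrAC; apply: ler_pM => //; first exact: HA1.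
  by rewrite (ger0_norm M0).
rewrite (le_trans (ler_norm_sum _ _ _))// [leRHS]mulr_suml.
rewrite [leRHS]big_ord_recl ler_wpDl//; first by rewrite !mulr_ge0 ?exprn_ge0// ltW// (HA _).1.
rewrite [leRHS]big_ord_recl ler_wpDl//; first by rewrite !mulr_ge0 ?exprn_ge0// ltW// (HA _).1.
apply: ler_sum => i _; rewrite normrM normrX mulrAC.
apply: ler_pM => //; first by apply: (HA (lift ord0 (lift ord0 i))).2 => //;
  rewrite (coef_nderivn_top sp _).1 /= /bump /=; have := ltn_ord i; lia.
by rewrite /= (ger0_norm M0); apply: Ms.
Qed.

End PolynomialAsymptotics.

(** * Spacing of matches between polynomial values *)

Section Spacing.
Variable R : realType.
Implicit Types (G H : {poly R}).
Local Open Scope classical_set_scope.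
Local Open Scope ring_scope.

Lemma near_mp (P Q : nat -> Prop) : (\forall x \near \oo, P x) ->
  (\forall x \near \oo, P x -> Q x) -> \forall x \near \oo, Q x.
Proof. by move=> PP PQ; apply: filter_app PP; apply: PQ. Qed.

(** A window of length at most sqrt (2x) is negligible against [c * x]. The factor 2 lets one window
    length serve both x and a later point x + t with t <= x. *)
Lemma window_small (c A : R) : 0 < c ->
  (* The threshold gives 2|A| <= c x, so a failure would give c x <= 2w, hence c^2 x^2 <= 8x,
     against c^2 x >= 9. *)
  \forall x \near \oo, forall w : R, w ^+ 2 <= 2 * x%:R -> A + w < c * x%:R.
Proof.
move=> c0; apply: filterS (nbhs_infty_ger (2 * `|A| / c + 9 / c ^+ 2)) => x hx1 w hw.
have c20 : 0 < c ^+ 2 by rewrite exprn_gt0.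
have h1 : 2 * `|A| <= c * x%:R.
  by rewrite [leRHS]mulrC -ler_pdivrMr// (le_trans _ hx1)// lerDl divr_ge0// ltW.
have h2 : 9 <= c ^+ 2 * x%:R.
  rewrite [leRHS]mulrC -ler_pdivrMr// (le_trans _ hx1)// lerDr divr_ge0 ?mulr_ge0//.
  exact: ltW.
have h3 := ler_norm A.
rewrite ltNge; apply/negP => h4.
have h5 : c * x%:R <= 2 * w by lra.
have x0 : (0 : R) < x%:R.
  by rewrite ltr0n lt0n; apply/eqP => xE; move: h2; rewrite xE mulr0; lra.
have h6 : 0 <= c * x%:R by rewrite mulr_ge0 ?ltW.
have h7 : (c * x%:R) ^+ 2 <= (2 * w) ^+ 2 by rewrite lerXn2r ?nnegrE//; lra.
have h8 : 9 * x%:R <= c ^+ 2 * x%:R * x%:R by rewrite ler_pM2r.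
by move: h7; rewrite !exprMn expr2; lra.
Qed.

(** The finitely many [y < N] give bounded values of [H], while [G] minus the window tends to
    infinity: partners of large x are large, so asymptotic bounds apply to them too. *)
Lemma match_large G H d (N : nat) : size G = d.+2 -> 0 < lead_coef G ->
  \forall x \near \oo, forall (y : nat) (w : R), w ^+ 2 <= 2 * x%:R ->
    `|G.[x%:R] - H.[y%:R]| <= w -> (N <= y)%N.
Proof.
move=> sG lG; have [U U1 HU] := poly_lower sG lG.
have fin : \forall x \near \oo, forall y : 'I_N, forall w : R,
    w ^+ 2 <= 2 * x%:R -> H.[y%:R] + w < lead_coef G / 2 * x%:R.
  by apply: filter_forall => y; apply: window_small; rewrite divr_gt0.
apply: (near_mp fin); apply: (near_mp (nbhs_infty_ger U)); apply: nearW.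
move=> x xU {}fin y w hw hxy.
rewrite leqNgt; apply/negP => yN.
have h1 := fin (Ordinal yN) w hw; rewrite /= in h1.
have h2 := HU _ xU; have x1 : 1 <= x%:R :> R by exact: le_trans xU.
have h3 : lead_coef G / 2 * x%:R <= lead_coef G / 2 * x%:R ^+ d.+1.
  by rewrite ler_pM2l ?divr_gt0// -[leLHS]expr1 ler_weXn2l.
by move: hxy; rewrite ler_norml => /andP[]; lra.
Qed.

(** This turns an integer that is close enough to the slope times t into one that is equal to it. *)
Lemma int_discrete (r : R) : exists2 delta : R, 0 < delta &
  forall s : int, s%:~R != r -> delta <= `|s%:~R - r|.
Proof.
have [/intrP[n ->]|rN] := boolP (r \is a Num.int).
  exists 1 => // s; rewrite eqr_int -intrB -subr_eq0 -intr_norm ler1z.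
  by rewrite -normr_gt0; lia.
have /andP[h1 h2] := floor_itv r.
set n := Num.floor r in h1 h2.
have h3 : n%:~R != r by apply: contraNneq rN => <-; rewrite intr_int.
have h4 : n%:~R < r by rewrite lt_neqAle h3.
exists (Num.min (r - n%:~R) ((n + 1)%:~R - r)); first by rewrite lt_min !subr_gt0 h4 h2.
move=> s _; rewrite ge_min; case: (leP s n) => sn.
  apply/orP; left; have : (s%:~R : R) <= n%:~R by rewrite ler_int.
  by move=> ?; rewrite ler0_norm; lra.
apply/orP; right; have : ((n + 1)%:~R : R) <= s%:~R by rewrite ler_int; lia.
by move=> ?; rewrite ger0_norm; lra.
Qed.

Lemma near_inftyS (Q : nat -> Prop) (t : nat) :
  (\forall x \near \oo, Q x) -> \forall x \near \oo, Q (x + t)%N.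
Proof.
move=> [N _ HN]; exists N => // n /= Nn; apply: HN => /=.
by rewrite (leq_trans Nn)// leq_addr.
Qed.

(** Two matches force [y1 < y2], so [H] grows by at least order y1^(d'+1), whereas [G] grows by
    order x^(d+1) only. But y1^(d'+2) is at least of order x^(d+2), the size of [G] at x.
    Eliminating [y1] compares x^((d+2)(d'+1)) with x^((d+1)(d'+2)), and the first exponent is larger
    by d' - d. *)
Lemma spacing_lt_degree G H d d' t : size G = d.+3 -> size H = d'.+3 -> (d < d')%N ->
  0 < lead_coef G -> 0 < lead_coef H -> (0 < t)%N ->
  \forall x \near \oo, forall (y1 y2 : nat) (w : R), w ^+ 2 <= 2 * x%:R ->
    `|G.[x%:R] - H.[y1%:R]| <= w -> `|G.[(x + t)%:R] - H.[y2%:R]| <= w -> False.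
Proof.
move=> sG sH dd lG lH t0.
have [A A0 HA] := poly_first_order t%:R sG.
have [U U1 HU] := poly_lower sG lG.
have [cG cG0 [UG UG1 HG]] := poly_increment sG lG.
have [cH cH0 [UH UH1 HH]] := poly_increment sH lH.
have [A' A'0 HA'] := poly_bound_ge1 H.
set a := lead_coef G in lG HA HU *.
(* The 2 pays for the two windows, each shorter than x. *)
pose C0 := a * d.+2%:R * t%:R + A + 2.
have C00 : 0 < C0 by rewrite /C0 ltr_wpDl// addr_ge0 ?mulr_ge0// ltW.
(* These constants remain when [H2] is raised to the power [d'.+1] and [H3] to the power [d'.+2], so
   that both concern the same power of [y1]. *)
pose K1 := (a / 4) ^+ d'.+1.
pose K2 := A' ^+ d'.+1 * (C0 / cH) ^+ d'.+2.
have K10 : 0 < K1 by rewrite exprn_gt0// divr_gt0.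
have K20 : 0 < K2 by rewrite mulr_gt0 ?exprn_gt0// divr_gt0.
have [N hN] := archi_nat_ge UH.
have N0 : (0 < N)%N by rewrite -(ltr0n R) (lt_le_trans _ hN)// (lt_le_trans _ UH1).
(* With [a / 4] the window eats at most half of the lower bound on [G]; with [cG / 2] the increment
   of [G] exceeds two windows, which gives [y1 < y2]. *)
have a4 : 0 < a / 4 by rewrite divr_gt0.
have c2 : 0 < cG / 2 by rewrite divr_gt0.
apply: (near_mp (match_large H N sG lG)).
apply: (near_mp (nbhs_infty_ger U)); apply: (near_mp (nbhs_infty_ger UG)).
apply: (near_mp (window_small 0 a4)); apply: (near_mp (window_small 0 c2)).
apply: (near_mp (window_small 0 ltr01)).
apply: (near_mp (near_inftyS t (match_large H N sG lG))).
apply: (near_mp (nbhs_infty_ger (K2 / K1 + 1))).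
apply: nearW => x xK y2N w3 w2 w1 xUG xU y1N y1 y2 w hw h1 h2.
have x1 : 1 <= x%:R :> R by exact: le_trans xU.
have x0 : 0 <= x%:R :> R by [].
have xd i : 1 <= x%:R ^+ i :> R by rewrite exprn_ege1.
have hwt : w ^+ 2 <= 2 * (x + t)%:R by rewrite (le_trans hw)// natrD mulrDr lerDl mulr_ge0.
move: y1N => /(_ y1 w hw h1) y1N; move: y2N => /(_ y2 w hwt h2) y2N.
move: w1 w2 w3 => /(_ w hw) + /(_ w hw) + /(_ w hw); rewrite !add0r mul1r => w1 w2 w3.
have y1U : UH <= y1%:R by rewrite (le_trans hN)// ler_nat.
have y2U : UH <= y2%:R by rewrite (le_trans hN)// ler_nat.
have xS i : x%:R <= x%:R ^+ i.+1 :> R by rewrite -[leLHS]expr1 ler_weXn2l.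
move: h1 h2; rewrite !ler_norml => /andP[h1 h1'] /andP[h2 h2'].
have G1 := HU _ xU.
have G2 : cG * x%:R <= G.[(x + t)%:R] - G.[x%:R].
  have := HG (x + t)%:R x%:R xUG; rewrite ler_nat leq_addr => /(_ isT); apply: le_trans.
  rewrite natrD (addrC _ t%:R) addrK -mulrA ler_pM2l// (le_trans (xS d))//.
  by rewrite ler_peMl ?exprn_ge0// ler1n.
have G3 : G.[(x + t)%:R] - G.[x%:R] <= (a * d.+2%:R * t%:R + A) * x%:R ^+ d.+1.
  have := HA x%:R t%:R x1; rewrite ger0_norm// lexx => /(_ isT); rewrite -natrD.
  move=> /ler_normlP[_]; rewrite mulrDl.
  have : A * x%:R ^+ d <= A * x%:R ^+ d.+1 by rewrite ler_pM2l// ler_weXn2l.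
  by lra.
have y12 : (y1 < y2)%N.
  rewrite ltnNge; apply/negP => y21.
  have := HH y1%:R y2%:R y2U; rewrite ler_nat y21 => /(_ isT).
  have : 0 <= cH * (y1%:R - y2%:R) * y2%:R ^+ d'.+1.
    by rewrite !mulr_ge0// ?exprn_ge0// ?subr_ge0 ?ler_nat// ltW.
  by lra.
have H1 : cH * y1%:R ^+ d'.+1 <= C0 * x%:R ^+ d.+1.
  have := HH y2%:R y1%:R y1U; rewrite ler_nat (ltnW y12) => /(_ isT).
  have : cH * y1%:R ^+ d'.+1 <= cH * (y2%:R - y1%:R) * y1%:R ^+ d'.+1.
    rewrite -mulrA ler_pM2l// ler_peMl ?exprn_ge0//.
    by rewrite -natrB ?(ltnW y12)// ler1n subn_gt0.
  by have := xS d; rewrite /C0 mulrDl; lra.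
have H2 : a / 4 * x%:R ^+ d.+2 <= A' * y1%:R ^+ d'.+2.
  have := HA' d'.+2 y1%:R; rewrite sH leqnn => /(_ isT (le_trans UH1 y1U)).
  move=> /ler_normlP[_].
  have : a / 4 * x%:R <= a / 4 * x%:R ^+ d.+2 by rewrite ler_pM2l.
  by lra.
have H3 : y1%:R ^+ d'.+1 <= C0 / cH * x%:R ^+ d.+1.
  by rewrite mulrAC ler_pdivlMr// mulrC.
have H4 : (a / 4 * x%:R ^+ d.+2) ^+ d'.+1 <= (A' * y1%:R ^+ d'.+2) ^+ d'.+1.
  by rewrite lerXn2r ?nnegrE// mulr_ge0 ?exprn_ge0// ltW.
have H5 : (y1%:R ^+ d'.+1) ^+ d'.+2 <= (C0 / cH * x%:R ^+ d.+1) ^+ d'.+2.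
  have q0 : 0 <= C0 / cH by rewrite divr_ge0// ltW.
  by rewrite lerXn2r// nnegrE ?exprn_ge0// mulr_ge0// exprn_ge0.
have H6 : K1 * x%:R ^+ (d.+2 * d'.+1) <= K2 * x%:R ^+ (d.+1 * d'.+2).
  have -> : K1 * x%:R ^+ (d.+2 * d'.+1) = (a / 4 * x%:R ^+ d.+2) ^+ d'.+1.
    by rewrite exprMn -exprM.
  have -> : K2 * x%:R ^+ (d.+1 * d'.+2) = A' ^+ d'.+1 * (C0 / cH * x%:R ^+ d.+1) ^+ d'.+2.
    by rewrite [in RHS](exprMn d'.+2) -exprM /K2 -[LHS]mulrA.
  by rewrite (le_trans H4)// exprMn ler_pM2l ?exprn_gt0// -exprM mulnC exprM.
have E : (d.+2 * d'.+1 = d.+1 * d'.+2 + (d' - d))%N.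
  have [k ->] : exists k, d' = (d + k.+1)%N by exists (d' - d.+1)%N; move: dd; clear; lia.
  by rewrite addKn; clear; lia.
move: H6; rewrite E exprD mulrCA [leRHS]mulrC ler_pM2l ?exprn_gt0//; last first.
  by rewrite (lt_le_trans _ x1).
move=> H6.
have : K1 * x%:R <= K2.
  apply: le_trans H6; rewrite ler_pM2l//.
  by have -> : (d' - d = (d' - d).-1.+1)%N by move: dd; clear; lia.
rewrite mulrC -ler_pdivlMr//; lra.
Qed.
End Spacing.

(** * Matches between polynomials of equal degree *)

Section SpacingEqual.
Variable R : realType.
Implicit Types (G H : {poly R}).
Local Open Scope classical_set_scope.
Local Open Scope ring_scope.

Lemma pos_root (a : R) n : 0 < a -> exists2 b, 0 < b & b ^+ n.+1 = a.
Proof.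
move=> a0; exists (a `^ n.+1%:R^-1); first exact: powR_gt0.
by rewrite -powR_mulrn ?powR_ge0// -powRrM mulVf ?powRr1 ?ltW.
Qed.

(** For this [b] the leading terms of [G] at x and of [H] at b x agree, so the values of [H] at y
    and at b x differ by order x^(d+1). Since [H] moves at least at that rate near b x, the distance
    from y to b x is bounded. *)
Lemma match_linear G H d (b : R) : size G = d.+3 -> size H = d.+3 ->
  0 < lead_coef G -> 0 < lead_coef H -> 0 < b ->
  lead_coef G = lead_coef H * b ^+ d.+2 -> exists2 M : R, 0 <= M &
  \forall x \near \oo, forall (y : nat) (w : R), w ^+ 2 <= 2 * x%:R ->
    `|G.[x%:R] - H.[y%:R]| <= w -> `|y%:R - b * x%:R| <= M.
Proof.
move=> sG sH lG lH b0 ab.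
have [A A0 HA] := poly_sub_lead sG.
have [A' A'0 HA'] := poly_sub_lead sH.
have [c c0 [U U1 HH]] := poly_increment sH lH.
set a := lead_coef G in lG HA ab *; set a' := lead_coef H in lH HA' ab *.
(* The 1 pays for the window, the other terms for the lower-order parts of [G] at x and of [H] at b
   x. *)
pose C := 1 + A + A' * b ^+ d.+1.
have C0 : 0 < C by rewrite /C addr_gt0 ?addr_gt0 ?mulr_gt0 ?exprn_gt0.
pose e := (b / 2) ^+ d.+1; have e0 : 0 < e by rewrite exprn_gt0 ?divr_gt0.
pose M := C / (c * e); have M0 : 0 < M by rewrite divr_gt0 ?mulr_gt0.
exists M; first exact: ltW.
have [N hN] := archi_nat_ge U.
apply: (near_mp (match_large H N sG lG)); apply: (near_mp (window_small 0 ltr01)).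
apply: (near_mp (nbhs_infty_ger (1 + 2 * U / b + 2 * M / b))).
apply: nearW => x xK w1 yN y w hw h1.
move: yN w1 => /(_ y w hw h1) yN /(_ w hw); rewrite add0r mul1r => w1.
have yU : U <= y%:R by rewrite (le_trans hN)// ler_nat.
have U0 : 0 <= U by rewrite (le_trans _ U1).
have t1 : 0 <= 2 * U / b by rewrite divr_ge0 ?mulr_ge0// ltW.
have t2 : 0 <= 2 * M / b by apply: divr_ge0; [apply: mulr_ge0 => //|]; apply: ltW.
have x1 : 1 <= x%:R :> R by lra.
have x0 : 0 < x%:R :> R by lra.
have bxU : U <= b / 2 * x%:R.
  have : 2 * U / b <= x%:R by lra.
  by rewrite ler_pdivrMr//; lra.
have bxM : M < b / 2 * x%:R.
  have : 2 * M / b < x%:R by lra.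
  by rewrite ltr_pdivrMr//; lra.
have bx1 : 1 <= b * x%:R by lra.
have xS : x%:R <= x%:R ^+ d.+1 :> R by rewrite -[leLHS]expr1 ler_weXn2l.
have X0 : 0 < x%:R ^+ d.+1 :> R by rewrite exprn_gt0.
have K : `|H.[y%:R] - H.[b * x%:R]| <= C * x%:R ^+ d.+1.
  have := HA _ x1; have := HA' _ bx1; rewrite !exprMn mulrA -ab.
  rewrite /C !mulrDl mul1r -mulrA; move: h1; rewrite !ler_norml.
  by move=> /andP[? ?] /andP[? ?] /andP[? ?]; apply/andP; split; lra.
have powle (u v : R) : 0 <= u -> u <= v -> u ^+ d.+1 <= v ^+ d.+1.
  by move=> u0 uv; rewrite lerXn2r// nnegrE// (le_trans u0).
have key (r : R) : c * r * (b / 2 * x%:R) ^+ d.+1 <= C * x%:R ^+ d.+1 -> r <= M.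
  rewrite exprMn -/e mulrA ler_pM2r// /M ler_pdivlMr ?mulr_gt0//.
  by rewrite [r * _]mulrA [r * c]mulrC.
have [ybx|ybx] := leP (b * x%:R) y%:R.
  rewrite ger0_norm ?subr_ge0//; apply: key.
  apply: le_trans (_ : H.[y%:R] - H.[b * x%:R] <= _); last first.
    by move: K; rewrite ler_norml => /andP[].
  apply: le_trans (HH _ _ _ ybx); last by lra.
  apply: ler_wpM2l; first by rewrite mulr_ge0 ?subr_ge0 ?(ltW c0).
  by apply: powle; lra.
rewrite ler0_norm ?subr_le0 ?(ltW ybx)// opprB.
(* The rate of [H] is used only above b x / 2, hence the truncation of [y] there. It is harmless:
   [M < b / 2 * x] excludes that the truncation takes effect. *)
pose v := Num.max y%:R (b / 2 * x%:R).
have vb : v <= b * x%:R by rewrite ge_max (ltW ybx) /=; lra.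
have vM : b * x%:R - v <= M.
  apply: key; apply: le_trans (_ : H.[b * x%:R] - H.[v] <= _).
    apply: le_trans (HH _ v _ vb); last by rewrite le_max yU.
    apply: ler_wpM2l; first by rewrite mulr_ge0 ?subr_ge0 ?(ltW c0).
    by apply: powle; rewrite ?le_max ?lexx ?orbT//; lra.
  have : H.[y%:R] <= H.[v].
    rewrite -subr_ge0; apply: le_trans (HH _ _ yU _); last by rewrite le_max lexx.
    by rewrite !mulr_ge0 ?exprn_ge0 ?(ltW c0)// subr_ge0 le_max lexx.
  by move: K; rewrite ler_norml => /andP[]; lra.
move: vM; rewrite /v; case: (leP y%:R (b / 2 * x%:R)) => // _ vM; lra.
Qed.

(** Combining the expansion of [G] at x with those of [H] at b x for both partners leaves y2 - y1 -
    b t times a constant times x^(d+1), against an error of order x^d plus two windows. An integer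
    y2 - y1 other than b t would stay a fixed distance [dl] away from it. *)
Lemma spacing_slope G H d (b : R) t : size G = d.+3 -> size H = d.+3 ->
  0 < lead_coef G -> 0 < lead_coef H -> 0 < b ->
  lead_coef G = lead_coef H * b ^+ d.+2 ->
  \forall x \near \oo, forall (y1 y2 : nat) (w : R), w ^+ 2 <= 2 * x%:R ->
    `|G.[x%:R] - H.[y1%:R]| <= w -> `|G.[(x + t)%:R] - H.[y2%:R]| <= w ->
    y2%:R - y1%:R = b * t%:R.
Proof.
move=> sG sH lG lH b0 ab.
have [M M0 HM] := match_linear sG sH lG lH b0 ab.
have [A A0 HA] := poly_first_order t%:R sG.
(* [y2] is within [M] of b (x + t), hence within [M'] of b x, so both partners can be expanded at
   the same point. *)
pose M' := M + b * t%:R.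
have [A' A'0 HA'] := poly_first_order M' sH.
have [dl dl0 Hdl] := int_discrete (b * t%:R).
set a := lead_coef G in lG HA ab *; set a' := lead_coef H in lH HA' ab *.
pose K := a' * b ^+ d.+1 * d.+2%:R * dl.
have K0 : 0 < K by rewrite !mulr_gt0// exprn_gt0.
have K20 : 0 < K / 2 by rewrite divr_gt0.
apply: (near_mp HM); apply: (near_mp (near_inftyS t HM)).
apply: (near_mp (window_small ((A + 2 * A' * b ^+ d) / 2) K20)).
apply: (near_mp (nbhs_infty_ger (1 + 1 / b))); apply: nearW.
move=> x xK w1 ym2 ym1 y1 y2 w hw h1 h2.
have ib0 : 0 < 1 / b by rewrite divr_gt0.
have x1 : 1 <= x%:R :> R by lra.
have x0 : 0 < x%:R :> R by lra.
have bx1 : 1 <= b * x%:R.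
  have : 1 / b <= x%:R by lra.
  by rewrite ler_pdivrMr//; lra.
have hwt : w ^+ 2 <= 2 * (x + t)%:R by rewrite (le_trans hw)// natrD mulrDr lerDl mulr_ge0.
move: ym1 ym2 w1 => /(_ _ _ hw h1) ym1 /(_ _ _ hwt h2) ym2 /(_ _ hw) w1.
have bt0 : 0 <= b * t%:R by rewrite mulr_ge0// ltW.
apply/eqP/negPn/negP => ne.
have := Hdl (y2%:Z - y1%:Z); rewrite intrB -!pmulrn => /(_ ne) hdl.
have E1 := HA x%:R t%:R x1; rewrite ger0_norm// lexx in E1; move: E1 => /(_ isT) E1.
have E2 := HA' (b * x%:R) (y1%:R - b * x%:R) bx1.
have E3 := HA' (b * x%:R) (y2%:R - b * x%:R) bx1.
have MM' : M <= M' by rewrite lerDl.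
have {}E2 := E2 (le_trans ym1 MM').
have /E3 {}E3 : `|y2%:R - b * x%:R| <= M'.
  have -> : y2%:R - b * x%:R = (y2%:R - b * (x + t)%:R) + b * t%:R.
    by rewrite natrD; ring.
  rewrite (le_trans (ler_normD _ _))// (ger0_norm bt0) lerD2r//.
rewrite ![b * x%:R + _]addrC !subrK in E2 E3; rewrite -natrD in E1.
set s : R := y2%:R - y1%:R - b * t%:R in hdl.
have F : `|a' * b ^+ d.+1 * d.+2%:R * s * x%:R ^+ d.+1| <=
    (A + 2 * A' * b ^+ d) * x%:R ^+ d + 2 * w.
  have -> : a' * b ^+ d.+1 * d.+2%:R * s * x%:R ^+ d.+1 =
     (a' * d.+2%:R * (y2%:R - b * x%:R) * (b * x%:R) ^+ d.+1) -
     (a' * d.+2%:R * (y1%:R - b * x%:R) * (b * x%:R) ^+ d.+1) -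
     (a * d.+2%:R * t%:R * x%:R ^+ d.+1).
    by rewrite ab /s exprMn [b ^+ d.+2]exprS; ring.
  move: E1 E2 E3 h1 h2; rewrite !(exprMn d b) !ler_norml !mulrA.
  do 5! move=> /andP[? ?]; apply/andP; split; lra.
have F2 : K * x%:R ^+ d.+1 <= (A + 2 * A' * b ^+ d) * x%:R ^+ d + 2 * w.
  have Kc0 : 0 < a' * b ^+ d.+1 * d.+2%:R by rewrite !mulr_gt0// exprn_gt0.
  have X0 : 0 < x%:R ^+ d.+1 :> R by rewrite exprn_gt0.
  apply: le_trans F; rewrite normrM (normrM _ s) (gtr0_norm Kc0) (gtr0_norm X0).
  by rewrite ler_pM2r// ler_pM2l.
have xd1 : 1 <= x%:R ^+ d :> R by rewrite exprn_ege1.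
have w0 : 0 <= w by rewrite (le_trans _ h1).
move: F2; rewrite exprS mulrA; set X := x%:R ^+ d in xd1 *.
have : w <= w * X by rewrite ler_peMr.
have : (A + 2 * A' * b ^+ d + 2 * w) * X < K * x%:R * X by rewrite ltr_pM2r; lra.
by rewrite mulrDl; lra.
Qed.

(** If b t is not an integer, y2 - y1 = b t is absurd. Otherwise t y1 - (b t) x is a bounded
    integer, so [y1] is one of finitely many rational affine functions of x. On each of them the
    difference of the values is a rational polynomial in x, which fits in the window for large x
    only if it is constant, and an integer constant yields a similarity. *)
Lemma spacing_eq_degree (g h : {poly rat}) d t : size g = d.+3 -> size h = d.+3 ->
  0 < lead_coef g -> 0 < lead_coef h -> (0 < t)%N -> ~ poly_sim g h ->
  \forall x \near \oo, forall (y1 y2 w : nat), (w ^ 2 <= 2 * x)%N ->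
    `|g.[x%:R] - h.[y1%:R]| <= w%:R -> `|g.[(x + t)%:R] - h.[y2%:R]| <= w%:R ->
    g.[x%:R] - h.[y1%:R] \is a Num.int -> False.
Proof.
move=> sg sh lg lh t0 nsim.
pose G : {poly R} := map_poly ratr g; pose H : {poly R} := map_poly ratr h.
have sG : size G = d.+3 by rewrite size_map_poly.
have sH : size H = d.+3 by rewrite size_map_poly.
have lG : 0 < lead_coef G by rewrite lead_coef_map ltr0q.
have lH : 0 < lead_coef H by rewrite lead_coef_map ltr0q.
have [b b0 bE] := pos_root d.+1 (divr_gt0 lG lH).
have ab : lead_coef G = lead_coef H * b ^+ d.+2 by rewrite bE mulrC divfK// gt_eqF.
have tr := @dist_ratr_nat R.
have trw (w x : nat) : (w ^ 2 <= 2 * x)%N -> (w%:R : R) ^+ 2 <= 2 * x%:R.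
  by rewrite -natrX -natrM ler_nat.
have [M M0 HM] := match_linear sG sH lG lH b0 ab.
have HS := spacing_slope t sG sH lG lH b0 ab.
have [/intrP[s sE]|bN] := boolP (b * t%:R \is a Num.int); last first.
  apply: (near_mp HS); apply: nearW => x Hx y1 y2 w hw h1 h2 _.
  move: bN; rewrite -(Hx y1 y2 w%:R (trw _ _ hw) (tr _ _ _ _ _ h1) (tr _ _ _ _ _ h2)).
  by rewrite rpredB// rpred_nat.
have tR : 0 < t%:R :> R by rewrite ltr0n.
have s0 : 0 < s by rewrite -(ltr0z R) -sE mulr_gt0.
have [N hN] := archi_nat_ge (t%:R * M).
(* [i - N] runs through the possible values of t y - s x in [-N, N]; there are finitely many, so
   their thresholds merge. *)
have fin : \forall x \near \oo, forall i : 'I_(2 * N).+1, forall (y w : nat),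
    t%:Z * y%:Z - s * x%:Z = i%:Z - N%:Z -> (w ^ 2 <= 2 * x)%N ->
    `|g.[x%:R] - h.[y%:R]| <= w%:R -> g.[x%:R] - h.[y%:R] \is a Num.int -> False.
  apply: filter_forall => i.
  pose be : rat := s%:~R / t%:R; pose ga : rat := (i%:Z - N%:Z)%:~R / t%:R.
  pose r := g - (h \Po (be *: 'X + ga%:P)).
  have tQ : t%:R != 0 :> rat by rewrite pnatr_eq0 -lt0n.
  have rE (x y : nat) : t%:Z * y%:Z - s * x%:Z = i%:Z - N%:Z ->
      r.[x%:R] = g.[x%:R] - h.[y%:R].
    move=> E; rewrite /r hornerD hornerN horner_comp; congr (_ - h.[_]).
    rewrite !hornerE /be /ga -E !intrD !intrN !intrM -!pmulrn.
    by field.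
  have [r1|r1] := leqP (size r) 1.
    apply: nearW => x y w E _ _; rewrite -(rE _ _ E); have -> := size1_polyC r1.
    rewrite hornerC => /intrP[n nE]; apply: nsim.
    exists be, ga, n; split; first by rewrite divr_gt0 ?ltr0z ?ltr0n.
    by rewrite -nE -(size1_polyC r1) /r addrC subrK.
  pose Rr : {poly R} := map_poly ratr r.
  have sR : size Rr = ((size r).-2).+2 by rewrite size_map_poly; move: r1; case: (size r) => [|[|k]].
  have [c c0 [U U1 HU]] := poly_abs_lower sR.
  apply: (near_mp (nbhs_infty_ger U)); apply: (near_mp (window_small 0 c0)).
  apply: nearW => x w1 xU y w E hw h1 _.
  have := HU _ xU; rewrite horner_ratr_nat (rE _ _ E) -ratr_norm => h2.
  have h3 : (ratr `|g.[x%:R] - h.[y%:R]| : R) <= w%:R by rewrite -(ratr_nat R w) ler_rat.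
  have := w1 _ (trw _ _ hw); rewrite add0r.
  have x1 : 1 <= x%:R :> R by rewrite (le_trans U1).
  have h4 : c * x%:R <= c * x%:R ^+ (size r).-2.+1.
    by rewrite ler_pM2l// -[leLHS]expr1 ler_weXn2l.
  by move=> /(le_lt_trans (le_trans h4 (le_trans h2 h3))); rewrite ltxx.
apply: (near_mp HM); apply: (near_mp HS); apply: (near_mp fin); apply: nearW.
move=> x Hfin Hslope Hlin y1 y2 w hw h1 h2 hint.
have {Hlin}L := Hlin _ _ (trw _ _ hw) (tr _ _ _ _ _ h1).
have vN : `|t%:Z * y1%:Z - s * x%:Z| <= N%:Z.
  rewrite -(ler_int R) intr_norm intrB !intrM -sE -!pmulrn.
  have -> : t%:R * y1%:R - b * t%:R * x%:R = t%:R * (y1%:R - b * x%:R) by ring.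
  by rewrite normrM ger0_norm// (le_trans _ hN)// ler_pM2l.
have /= H1 i := Hfin i y1 w; move: H1; move: vN.
move: (t%:Z * y1%:Z - s * x%:Z) => v vN H1.
have vi : (absz (v + N%:Z)%R < (2 * N).+1)%N by move: vN; clear; lia.
apply: (H1 (Ordinal vi)) => //=; move: vN; clear; lia.
Qed.
End SpacingEqual.

(** * Norms of integer polynomials at Pisot and Salem numbers *)

Section IntegerNorm.
Import Pdiv.Ring Pdiv.RingMonic.

(** The product is a norm: [M] is the matrix of multiplication by [G] on Z[X]/(p) in the basis of
    powers of X, and the Vandermonde matrix of the roots diagonalises it. Distinct roots make that
    matrix invertible, so the product is the determinant of the integer matrix [M]. *)
Lemma prod_conjugates_int (C : fieldType) (p : {poly int}) (rs : seq C)
    (G : {poly int}) :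
  p \is monic -> map_poly intr p = \prod_(z <- rs) ('X - z%:P) -> uniq rs ->
  exists N : int, \prod_(z <- rs) (map_poly intr G).[z] = N%:~R.
Proof.
move=> pm pE urs; pose n := size rs.
have sp : size p = n.+1.
  by rewrite -(size_prod_XsubC rs id) -pE size_map_poly_id0// (monicP pm) oner_eq0.
pose W i : {poly int} := rmodp ('X^i * G) p.
pose M : 'M[int]_n := \matrix_(i, k) (W i)`_k.
pose zs : 'rV[C]_n := \row_j rs`_j.
pose V : 'M[C]_n := Vandermonde n zs.
have WE i (z : C) : z \in rs -> (map_poly intr (W i)).[z] = z ^+ i * (map_poly intr G).[z].
  move=> zrs; have pz : (map_poly intr p).[z] = 0.
    by apply/rootP; rewrite pE root_prod_XsubC.
  have := congr1 (fun P => (map_poly intr P).[z]) (rdivp_eq pm ('X^i * G)).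
  rewrite /= !rmorphD !rmorphM /= !hornerE map_polyXn hornerXn => ->.
  by rewrite pz mulr0 add0r.
have MV : map_mx intr M *m V = V *m diag_mx (\row_j (map_poly intr G).[rs`_j]).
  apply/matrixP => i j; rewrite !mxE [RHS](bigD1 j)//= [X in _ + X]big1 => [|k kj]; last first.
    by rewrite !mxE (negPf kj) mulr0n mulr0.
  rewrite addr0 !mxE eqxx mulr1n -WE ?mem_nth//.
  rewrite (@horner_coef_wide _ n); last first.
    rewrite (leq_trans (size_poly _ _))// -ltnS -sp; apply: ltn_rmodpN0.
    by rewrite monic_neq0.
  by apply: eq_bigr => k _; rewrite !mxE coef_map.
have detV : \det V != 0.
  rewrite det_Vandermonde; apply/prodf_neq0 => i _; apply/prodf_neq0 => j ij.
  by rewrite !mxE subr_eq0 nth_uniq// gtn_eqF.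
exists (\det M); apply: (mulfI detV).
have := congr1 determinant MV.
rewrite !det_mulmx det_diag det_map_mx [LHS]mulrC => ->; congr (_ * _).
by rewrite (big_nth 0) big_mkord; apply: eq_bigr => j _; rewrite mxE.
Qed.

End IntegerNorm.

Section PisotSalem.
Variable R : realType.

Lemma norm_complex_of_real (x : R) : `|x%:C%C| = (`|x|)%:C%C :> R[i].
Proof.
have [x0|x0] := leP 0 x.
  by rewrite !ger0_norm// lecR.
by rewrite !ltr0_norm ?ltcR// rmorphN.
Qed.

Lemma horner_int_complex (w : {poly int}) (q : R) :
  (map_poly intr w).[q%:C%C] = ((map_poly intr w).[q])%:C%C.
Proof.
rewrite -(horner_map (real_complex R)) -map_poly_comp; congr (_.[_]).
by apply: eq_map_poly => x /=; rewrite rmorph_int.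
Qed.

(** Gauss's lemma: the minimal polynomial over Q, rescaled to a factor in Z[X] of a monic
    polynomial, has leading coefficient 1 or -1, and multiplying by that sign makes it monic. *)
Lemma algebraic_integer_minpoly (q : R) : algebraic_integer q ->
  exists p : {poly int}, [/\ p \is monic, root (map_poly intr p) q &
    irreducible_poly (map_poly intr p : {poly rat})].
Proof.
move=> [P Pm Pq].
pose Q n := `[< exists pr : {poly rat},
  [/\ pr != 0, root (map_poly (ratr : rat -> R) pr) q & size pr = n] >].
have exQ : exists n, Q n.
  exists (size (map_poly intr P : {poly rat})); apply/asboolP.
  exists (map_poly intr P); rewrite map_ratr_intr; split => //.
  by rewrite map_poly_eq0_id0 ?monic_neq0// (monicP Pm) oner_eq0.
case: (ex_minnP exQ) => n /asboolP[pm [pm0 pmq spm]] nmin.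
have pmin (r : {poly rat}) : root (map_poly (ratr : rat -> R) r) q -> r != 0 ->
    (size pm <= size r)%N.
  by move=> rq r0; rewrite spm; apply: nmin; apply/asboolP; exists r.
have pmP : pm %| map_poly intr P.
  apply: contraT => r0; have := pmin (map_poly intr P %% pm).
  move=> /(_ _ r0); rewrite leqNgt ltn_modp pm0 => H; apply: H.
  rewrite rootE; have := congr1 (fun p => (map_poly ratr p).[q]) (divp_eq (map_poly intr P) pm).
  by rewrite /= rmorphD rmorphM /= !hornerE map_ratr_intr (rootP Pq) (rootP pmq) mulr0 add0r => <-.
have [p1 [a a0 pmE] [r PE]] := dvdpP_rat_int pmP.
have lc : lead_coef p1 * lead_coef r = 1.
  by rewrite -lead_coefM -PE; apply/monicP.
have l2 : lead_coef p1 * lead_coef p1 = 1.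
  move: lc; clear; move: (lead_coef p1) (lead_coef r) => u v uv.
  have /andP[] : (u != 0) && (v != 0) by apply/andP; split; apply: contra_eq_neq uv => ->; rewrite ?mul0r ?mulr0.
  by nia.
have p10 : p1 != 0 by apply: contra_eq_neq l2 => ->; rewrite lead_coef0 mul0r.
pose l := lead_coef p1; have l0 : l != 0 by rewrite lead_coef_eq0.
have E : map_poly intr (l *: p1) = (l%:~R / a) *: pm :> {poly rat}.
  by rewrite map_polyZ /= pmE scalerA divfK.
have la0 : l%:~R / a != 0 :> rat by rewrite mulf_neq0 ?invr_eq0 ?intr_eq0.
have mr : root (map_poly (ratr : rat -> R) (map_poly intr (l *: p1))) q.
  by rewrite E map_polyZ /= rootZ ?fmorph_eq0.
exists (l *: p1); split.
- by rewrite monicE lead_coefZ l2.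
- by rewrite -(map_ratr_intr R).
apply/(fieldext.subfx_irreducibleP mr); first by rewrite E scaler_eq0 negb_or la0.
by move=> s; rewrite E size_scale//; apply: pmin.
Qed.

Lemma irreducible_coprime (F : fieldType) (p r : {poly F}) : irreducible_poly p ->
  ~~ coprimep p r -> p %| r.
Proof.
move=> [_ irr]; rewrite coprimep_def => sg.
by rewrite -(eqp_dvdl _ (irr _ sg (dvdp_gcdl _ _))) dvdp_gcdr.
Qed.

Lemma irreducible_coprime_deriv (p : {poly rat}) :
  irreducible_poly p -> coprimep p p^`().
Proof.
move=> irr; have sp := irr.1; apply/negPn/negP => /(irreducible_coprime irr).
have d0 : p^`() != 0.
  apply/eqP => /polyP /(_ (size p).-2); rewrite coef_deriv coef0 => /eqP.
  have -> : (size p).-2.+1 = (size p).-1 by move: sp; case: (size p) => [|[|k]].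
  rewrite mulrn_eq0 -lead_coefE lead_coef_eq0 => /orP[|/eqP p0]; last by rewrite p0 size_poly0 in sp.
  by move: sp; case: (size p) => [|[|k]].
move=> /(dvdp_leq d0); rewrite leqNgt lt_size_deriv//.
by rewrite -size_poly_gt0 (leq_trans _ sp).
Qed.

(** [r] counts the conjugates other than [q]. They lie in the closed unit disc, so the norm of [G]
    at [q] is an integer below 1 in absolute value. Norm zero means that [G] vanishes at some
    conjugate; the minimal polynomial then divides [G]. *)
Lemma conjugates_bounded_zero (q : R) : pisot q \/ salem q ->
  exists r : nat, forall (G : {poly int}) (M : R), 0 <= M ->
    (forall z : R[i], `|z| <= 1 -> `|(map_poly intr G).[z]| <= M%:C%C) ->
    `|(map_poly intr G).[q]| * M ^+ r < 1 -> (map_poly intr G).[q] = 0.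
Proof.
move=> qPS.
have [qint conj] : algebraic_integer q /\
    (forall z : R[i], galois_conjugate q z -> z != q%:C%C -> `|z| <= 1).
  case: qPS => [[h1 _ h2]|[h1 _ h2 _]]; split => // z h3 h4.
  by apply: ltW; apply: h2.
have [p [pm pq irr]] := algebraic_integer_minpoly qint.
pose pC : {poly R[i]} := map_poly intr p.
have pCm : lead_coef pC = 1.
  by rewrite lead_coef_map_id0 ?(monicP pm)// oner_eq0.
have [rs rsE] := closed_field_poly_normal pC; rewrite pCm scale1r in rsE.
have urs : uniq rs.
  rewrite -separable.separable_prod_XsubC -rsE separable.separable_poly.unlock.
  by rewrite /pC -map_ratr_intr deriv_map coprimep_map irreducible_coprime_deriv.
have rootrs z : (z \in rs) = root pC z by rewrite rsE root_prod_XsubC.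
have qrs : q%:C%C \in rs by rewrite rootrs rootE horner_int_complex (rootP pq).
exists (size (rem q%:C%C rs)) => G M M0 HG small.
have [N NE] := prod_conjugates_int G pm rsE urs.
have rem_le : `|\prod_(z <- rem q%:C%C rs) (map_poly intr G).[z]| <=
    (M ^+ size (rem q%:C%C rs))%:C%C.
  have gen (s : seq R[i]) : {in s, forall z, `|(map_poly intr G).[z]| <= M%:C%C} ->
      `|\prod_(z <- s) (map_poly intr G).[z]| <= (M ^+ size s)%:C%C.
    elim: s => [|z s IH] Hs; first by rewrite big_nil normr1.
    rewrite big_cons normrM /= exprS rmorphM /= ler_pM//.
      by apply: Hs; rewrite mem_head.
    by apply: IH => y ys; apply: Hs; rewrite in_cons ys orbT.
  apply: gen => z; rewrite mem_rem_uniq// inE => /andP[zq zr]; apply: HG.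
  apply: conj => //; exists (map_poly intr p); rewrite !map_ratr_intr; split => //.
  by rewrite -rootrs.
have N0 : N = 0.
  have : `|N%:~R : R[i]| < 1.
    rewrite -NE (big_rem _ qrs) /= normrM horner_int_complex norm_complex_of_real.
    apply: (@le_lt_trans _ _ ((`|(map_poly intr G).[q]| * M ^+ size (rem q%:C%C rs))%:C%C)).
      by rewrite rmorphM /= ler_wpM2l// lecR.
    by move: small; rewrite -ltcR.
  by rewrite -intr_norm ltrz1; lia.
move: NE; rewrite N0 => /eqP; rewrite prodf_seq_eq0 => /hasP[z zrs Gz].
have : map_poly intr p %| (map_poly intr G : {poly rat}).
  apply: (irreducible_coprime irr).
  rewrite -(coprimep_map (ratr : {rmorphism rat -> R[i]})) !map_ratr_intr.
  apply/negP => /coprimep_root /(_ _) H; have := H z.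
  by rewrite -rootrs zrs (eqP Gz) eqxx => /(_ isT).
move=> /dvdpP[s sE]; have := congr1 (fun P => (map_poly (ratr : rat -> R) P).[q]) sE.
by rewrite /= rmorphM /= !map_ratr_intr hornerM (rootP pq) mulr0.
Qed.

End PisotSalem.

(** * Vanishing at isolated exponents *)

Section Gap.
Variable R : realType.
Implicit Types (q : R) (b : nat -> R).
Local Open Scope classical_set_scope.
Local Open Scope ring_scope.

Lemma expr_dominates q K : 1 < q ->
  exists2 C : R, 0 < C & forall n : nat, n.+1%:R ^+ K <= C * q ^+ n.
Proof.
move=> q1; have q0 : 0 < q by apply: lt_trans q1.
case: K => [|K].
  by exists 1 => // n; rewrite expr0 mul1r exprn_ege1// ltW.
have lq : 0 < ln q by rewrite ln_gt0.
have f0 : 0 < (K.+1)`!%:R :> R by rewrite ltr0n fact_gt0.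
exists ((K.+1)`!%:R / ln q ^+ K.+1 * q).
  by rewrite mulr_gt0// divr_gt0// exprn_gt0.
move=> n; rewrite -[leRHS]mulrA -(exprS q n).
have x0 : 0 <= n.+1%:R * ln q by rewrite mulr_ge0// ltW.
have := expR_ge1Dxn K x0; rewrite expRM_natl lnK ?posrE// => H.
rewrite mulrAC ler_pdivlMr ?exprn_gt0// -exprMn [leRHS]mulrC -ler_pdivrMr//.
by apply: le_trans H; rewrite lerDr.
Qed.

Lemma geometric_partial_le (r : R) n : 0 <= r -> r < 1 ->
  \sum_(0 <= t < n) r ^+ t <= (1 - r)^-1.
Proof.
move=> r0 r1; have r10 : 0 < 1 - r by rewrite subr_gt0.
rewrite -[leRHS]mul1r ler_pdivlMr//.
suff -> : (\sum_(0 <= t < n) r ^+ t) * (1 - r) = 1 - r ^+ n by rewrite gerBl exprn_ge0.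
elim: n => [|n IH]; first by rewrite big_nil mul0r expr0 subrr.
by rewrite big_nat_recr//= mulrDl IH exprS; ring.
Qed.

(** The tail is comparable to its first term: N + t + 1 <= (N + 1)(t + 1) factors that term out, and
    half of [q ^+ t] (a power of [s], the square root of [q]) absorbs the power of t + 1, leaving a
    geometric series. *)
Lemma expr_tail_bound q K : 1 < q -> exists2 T : R, 0 < T &
  forall N n, \sum_(N <= k < n) k.+1%:R ^+ K / q ^+ k <= T * (N.+1%:R ^+ K / q ^+ N).
Proof.
move=> q1; have q0 : 0 < q by apply: lt_trans q1.
pose s := Num.sqrt q; have sE : s ^+ 2 = q by rewrite sqr_sqrtr// ltW.
have s1 : 1 < s by rewrite -sqrtr1 ltr_sqrt.
have s0 : 0 < s by apply: lt_trans s1.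
have [C C0 HC] := expr_dominates K s1.
have r0 : 0 <= s^-1 by rewrite invr_ge0 ltW.
have r1 : s^-1 < 1 by rewrite invf_lt1.
exists (C * (1 - s^-1)^-1); first by rewrite mulr_gt0// invr_gt0 subr_gt0.
move=> N n; have [nN|Nn] := leqP n N.
  rewrite big_geq// mulr_ge0//; last by rewrite divr_ge0 ?exprn_ge0// ltW.
  by rewrite mulr_ge0 ?(ltW C0)// invr_ge0 subr_ge0 ltW.
rewrite -{1}(add0n N) big_addn.
apply: (@le_trans _ _ (\sum_(0 <= t < n - N)
    (N.+1%:R ^+ K / q ^+ N * (C * (s^-1) ^+ t)))).
  apply: ler_sum => t _.
  apply: (@le_trans _ _ (N.+1%:R ^+ K / q ^+ N * (t.+1%:R ^+ K / q ^+ t))).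
    rewrite addnC exprD invfM mulrACA ler_wpM2r ?mulr_ge0 ?invr_ge0 ?exprn_ge0 ?(ltW q0)//.
    rewrite -exprMn lerXn2r ?nnegrE ?mulr_ge0// -natrM ler_nat; lia.
  rewrite ler_wpM2l ?divr_ge0 ?exprn_ge0 ?(ltW q0)//.
  rewrite ler_pdivrMr ?exprn_gt0// (le_trans (HC t))//.
  rewrite -sE -exprM mulnC exprM expr2 exprVn -!mulrA mulKf ?lexx// expf_neq0//.
  by rewrite gt_eqF.
rewrite -mulr_sumr -mulr_sumr mulrC ler_wpM2r ?divr_ge0 ?exprn_ge0 ?(ltW q0)//.
by rewrite ler_pM2l// geometric_partial_le.
Qed.

(** The disc of radius [q] serves two purposes: it contains [q], where the bound controls [b k]
    itself, and, for [q > 1], the unit disc, where it controls the conjugates. *)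
Definition integral_growth q b := exists (a : nat -> {poly int}) (A : R) (K : nat),
  [/\ 0 <= A, forall k, (map_poly intr (a k)).[q] = b k &
    forall k (z : R[i]), `|z| <= q%:C%C ->
      `|(map_poly intr (a k)).[z]| <= (A * k.+1%:R ^+ K)%:C%C].

Lemma poly_bound_disc (w : {poly int}) q : 0 <= q -> exists2 A : R, 0 <= A &
  forall z : R[i], `|z| <= q%:C%C -> `|(map_poly intr w).[z]| <= A%:C%C.
Proof.
move=> q0; elim/poly_ind: w => [|p c [A A0 HA]].
  by exists 0 => // z _; rewrite rmorph0 horner0 normr0.
exists (A * q + `|c|%:~R) => [|z zq]; first by rewrite addr_ge0 ?mulr_ge0// ler0z.
rewrite rmorphD rmorphM /= map_polyX map_polyC hornerMXaddC rmorphD rmorphM /=.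
rewrite (le_trans (ler_normD _ _))// lerD//.
  by rewrite normrM ler_pM// HA.
by rewrite rmorph_int -intr_norm.
Qed.

Lemma integral_growth_bound q b : 0 <= q -> integral_growth q b ->
  exists (A : R) (K : nat), 0 <= A /\ forall k, `|b k| <= A * k.+1%:R ^+ K.
Proof.
move=> q0 [a [A [K [A0 aE HA]]]]; exists A, K; split => // k.
have := HA k q%:C%C; rewrite norm_complex_of_real ger0_norm// lexx => /(_ isT).
by rewrite horner_int_complex norm_complex_of_real lecR aE.
Qed.

Lemma vanishing_before_gap q b : pisot q \/ salem q -> integral_growth q b ->
  (fun n => \sum_(0 <= k < n) b k / q ^+ k) @ \oo --> (0 : R) ->
  exists (A : R) (K : nat), 0 < A /\ forall E W,
    A * (E + W).+2%:R ^+ K < q ^+ W ->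
    (forall k, (E < k <= E + W)%N -> b k = 0) ->
    \sum_(0 <= k < E.+1) b k / q ^+ k = 0.
Proof.
move=> qPS bg blim.
have q1 : 1 < q by case: qPS => -[].
have q0 : 0 < q by apply: lt_trans q1.
have [r Hr] := conjugates_bounded_zero qPS.
have [A' [K' [A'0 bA]]] := integral_growth_bound (ltW q0) bg.
have [a [A [K [A0 aE HA]]]] := bg.
have [T T0 HT] := expr_tail_bound K' q1.
(* [A' * T] and [K'] come from the tail of the series; [A ^+ r] and [K.+1 * r] come from [M ^+ r],
   the extra power in [M] counting the [E.+1] summands of [G]. The 1 only ensures positivity. *)
exists (1 + A' * T * A ^+ r), (K' + K.+1 * r)%N; split.
  by rewrite ltr_pwDl// mulr_ge0 ?exprn_ge0// mulr_ge0// ltW.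
move=> E W hEW hgap; set S := \sum_(0 <= k < E.+1) _.
pose X : R := (E + W).+2%:R.
have X1 : 1 <= X by rewrite ler1n.
(* The full sum is 0 and the gap contributes nothing, so [S] is minus a tail that starts at
   [E + W + 1]. *)
have tail : `|S| <= A' * (T * (X ^+ K' / q ^+ (E + W).+1)).
  rewrite leNgt; apply/negP; rewrite -subr_gt0 => eps0.
  have /cvgr0Pnorm_lt /(_ _ eps0)[N _ HN] := blim.
  pose n := maxn N (E + W).+2.
  have := HN n; rewrite /= leq_maxl => /(_ isT).
  rewrite (big_cat_nat (n := E.+1))//=; last by rewrite /n; lia.
  rewrite (big_cat_nat (m := E.+1) (n := (E + W).+1))//=; [|lia|by rewrite /n; lia].
  have -> : \sum_(E.+1 <= k < (E + W).+1) b k / q ^+ k = 0.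
    rewrite big_nat_cond big1// => k /andP[hk _]; rewrite hgap ?mul0r//.
  rewrite add0r -/S.
  set t := \sum_(_ <= k < n) _; apply/negP; rewrite -leNgt.
  have : `|t| <= A' * (T * (X ^+ K' / q ^+ (E + W).+1)).
    rewrite (le_trans (ler_norm_sum _ _ _))//.
    apply: (@le_trans _ _ (A' * \sum_((E + W).+1 <= k < n) k.+1%:R ^+ K' / q ^+ k)).
      rewrite mulr_sumr; apply: ler_sum => k _.
      by rewrite normrM normfV normrX (gtr0_norm q0) mulrA ler_wpM2r// invr_ge0 exprn_ge0// ltW.
    by rewrite ler_wpM2l.
  have := ler_normB (S + t) t; rewrite addrK; lra.
(* Multiplying by [q ^+ E] removes all negative powers, so the same polynomial can be evaluated at
   the conjugates. *)
pose G : {poly int} := \sum_(0 <= k < E.+1) a k * 'X^(E - k).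
have Gq : (map_poly intr G).[q] = q ^+ E * S.
  rewrite /G rmorph_sum /= horner_sum mulr_sumr; apply: eq_big_nat => k kE.
  rewrite rmorphM /= map_polyXn hornerM hornerXn aE [RHS]mulrCA; congr (_ * _).
  have kE' : (k <= E)%N by move: kE; clear; lia.
  by rewrite -{2}(subnK kE') exprD mulfK// expf_neq0// gt_eqF.
pose M : R := A * X ^+ K.+1.
have M0 : 0 <= M by rewrite mulr_ge0// exprn_ge0.
have GM (z : R[i]) : `|z| <= 1 -> `|(map_poly intr G).[z]| <= M%:C%C.
  move=> z1; have zq : `|z| <= q%:C%C by rewrite (le_trans z1)// lecR ltW.
  rewrite /G rmorph_sum /= horner_sum (le_trans (ler_norm_sum _ _ _))//.
  apply: (@le_trans _ _ (\sum_(0 <= k < E.+1) (A * X ^+ K)%:C%C)).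
    rewrite big_nat_cond [leRHS]big_nat_cond.
    apply: ler_sum => k /andP[kE _]; rewrite rmorphM /= map_polyXn hornerM hornerXn normrM normrX.
    apply: (@le_trans _ _ ((A * k.+1%:R ^+ K)%:C%C * 1)).
      by rewrite ler_pM ?exprn_ge0// ?HA// exprn_ile1.
    rewrite mulr1 lecR ler_wpM2l// lerXn2r ?nnegrE// /X ler_nat; lia.
  rewrite sumr_const_nat subn0 -rmorphMn /= lecR /M exprS mulrCA -mulr_natl.
  by rewrite ler_wpM2r ?mulr_ge0 ?exprn_ge0// /X ler_nat; lia.
have := Hr G M M0 GM; rewrite Gq => H.
suff /H /eqP : `|q ^+ E * S| * M ^+ r < 1.
  by rewrite mulf_eq0 expf_eq0 gt_eqF// andbF /= => /eqP.
rewrite normrM normrX (gtr0_norm q0).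
apply: (@le_lt_trans _ _ (q ^+ E * (A' * (T * (X ^+ K' / q ^+ (E + W).+1))) * M ^+ r)).
  by rewrite ler_wpM2r ?exprn_ge0// ler_wpM2l// exprn_ge0// ltW.
have -> : q ^+ E * (A' * (T * (X ^+ K' / q ^+ (E + W).+1))) * M ^+ r =
   A' * T * A ^+ r * X ^+ (K' + K.+1 * r) / q ^+ W.+1.
  rewrite /M exprMn -exprM -addnS !exprD exprM; field.
  by rewrite !expf_neq0 ?gt_eqF.
rewrite ltr_pdivrMr ?exprn_gt0// mul1r.
apply: (@lt_trans _ _ (q ^+ W)); last by rewrite ltr_eXn2l.
apply: le_lt_trans hEW; rewrite -/X ler_wpM2r ?exprn_ge0// lerDr//.
Qed.

(** The gap after [e] kills the partial sum up to [e], the gap before it kills the one up to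
    [e - W - 1], and the two differ by the term of index [e] alone. With [W < e], the quantity
    [(2 * e).+2] dominates both sizes that occur. *)
Lemma isolated_vanishing q b : pisot q \/ salem q -> integral_growth q b ->
  (fun n => \sum_(0 <= k < n) b k / q ^+ k) @ \oo --> (0 : R) ->
  exists (A : R) (K : nat), 0 < A /\ forall e W,
    A * (2 * e).+2%:R ^+ K < q ^+ W -> (W < e)%N ->
    (forall k, (e - W <= k <= e + W)%N -> k <> e -> b k = 0) -> b e = 0.
Proof.
move=> qPS bg blim; have [A [K [A0 H]]] := vanishing_before_gap qPS bg blim.
have q1 : 1 < q by case: qPS => -[].
have q0 : 0 < q by apply: lt_trans q1.
exists A, K; split => // e W hW We hiso.
have mono n : (n <= (2 * e).+2)%N -> A * n%:R ^+ K < q ^+ W.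
  move=> ne; apply: le_lt_trans hW.
  by rewrite ler_pM2l// lerXn2r ?nnegrE// ler_nat.
have H1 : \sum_(0 <= k < e.+1) b k / q ^+ k = 0.
  apply: (H e W); first by apply: mono; lia.
  by move=> k hk; apply: hiso; lia.
have H2 : \sum_(0 <= k < e - W) b k / q ^+ k = 0.
  have -> : (e - W = (e - W.+1).+1)%N by lia.
  apply: (H _ W); first by apply: mono; lia.
  by move=> k hk; apply: hiso; lia.
move: H1; rewrite big_nat_recr//= (big_cat_nat (n := (e - W)%N))//=; last by lia.
rewrite H2 add0r big_nat_cond big1 ?add0r.
  by move=> /eqP; rewrite mulf_eq0 invr_eq0 expf_eq0 (gt_eqF q0) andbF orbF => /eqP.
by move=> k /andP[hk _]; rewrite hiso ?mul0r//; lia.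
Qed.

Lemma integral_growthD q b1 b2 : integral_growth q b1 -> integral_growth q b2 ->
  integral_growth q (fun k => b1 k + b2 k).
Proof.
move=> [a1 [A1 [K1 [A10 aE1 H1]]]] [a2 [A2 [K2 [A20 aE2 H2]]]].
exists (fun k => a1 k + a2 k), (A1 + A2), (K1 + K2)%N; split; first exact: addr_ge0.
  by move=> k; rewrite rmorphD hornerD aE1 aE2.
move=> k z zq; rewrite rmorphD hornerD (le_trans (ler_normD _ _))// mulrDl rmorphD /= lerD//.
  by rewrite (le_trans (H1 k z zq))// lecR ler_wpM2l// ler_weXn2l ?ler1n// leq_addr.
by rewrite (le_trans (H2 k z zq))// lecR ler_wpM2l// ler_weXn2l ?ler1n// leq_addl.
Qed.

Lemma integral_growth0 q : integral_growth q (fun=> 0).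
Proof.
by exists (fun=> 0), 0, 0%N; split => // [k|k z _]; rewrite rmorph0 horner0// normr0 mul0r.
Qed.

Lemma integral_growth_sum q (I : finType) (b : I -> nat -> R) :
  (forall i, integral_growth q (b i)) -> integral_growth q (fun k => \sum_i b i k).
Proof.
move=> H; elim: (index_enum I) => [|i s IH].
  rewrite (_ : (fun _ => _) = fun=> 0); first exact: integral_growth0.
  by apply/funext => k; rewrite big_nil.
rewrite (_ : (fun _ => _) = (fun k => b i k + \sum_(j <- s) b j k)).
  exact: integral_growthD.
by apply/funext => k; rewrite big_cons.
Qed.

Lemma integral_growth_dirac q (w : {poly int}) : 0 <= q ->
  integral_growth q (fun k => if k == 0%N then (map_poly intr w).[q] else 0).
Proof.
move=> q0; have [A A0 HA] := poly_bound_disc w q0.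
exists (fun k => if k == 0%N then w else 0), A, 0%N; split => // [k|k z zq].
  by case: eqP => // _; rewrite rmorph0 horner0.
by rewrite expr0 mulr1; case: eqP => // _; [exact: HA|rewrite rmorph0 horner0 normr0 lecR].
Qed.

Lemma integral_growth_scatter q b (e : nat -> nat) : integral_growth q b ->
  integral_growth q (fun k => \sum_(1 <= n < k.+1 | e n == k) b n).
Proof.
move=> [a [A [K [A0 aE HA]]]].
exists (fun k => \sum_(1 <= n < k.+1 | e n == k) a n), A, K.+1; split => // [k|k z zq].
  by rewrite rmorph_sum horner_sum; apply: eq_bigr => n _; exact: aE.
rewrite rmorph_sum horner_sum (le_trans (ler_norm_sum _ _ _))//.
apply: (@le_trans _ _ (\sum_(1 <= n < k.+1) (A * k.+1%:R ^+ K)%:C%C)).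
  rewrite big_mkcond big_nat_cond [leRHS]big_nat_cond; apply: ler_sum => n /andP[hn _].
  case: ifP => _; last by rewrite lecR mulr_ge0 ?exprn_ge0.
  rewrite (le_trans (HA _ _ zq))// lecR ler_wpM2l// lerXn2r ?nnegrE// ler_nat; lia.
rewrite sumr_const_nat -rmorphMn /= lecR exprS mulrCA -mulr_natl ler_wpM2r ?ler_nat//.
  by rewrite mulr_ge0 ?exprn_ge0.
by lia.
Qed.

Lemma integral_growth_poly q (P : {poly R}) : 0 <= q ->
  (forall t, exists w : {poly int}, P`_t = (map_poly intr w).[q]) ->
  integral_growth q (fun n => P.[n%:R]).
Proof.
move=> q0 /choice[w Pw].
have E : forall t, exists A : R, 0 <= A /\ forall z : R[i], `|z| <= q%:C%C ->
    `|(map_poly intr (w t)).[z]| <= A%:C%C.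
  by move=> t; have [A A0 HA] := poly_bound_disc (w t) q0; exists A.
move: E => /choice[A HA].
exists (fun n => \sum_(t < size P) w t *+ (n ^ t)), (\sum_(t < size P) A t), (size P).
split; first by apply: sumr_ge0 => t _; exact: (HA t).1.
  move=> n; rewrite rmorph_sum horner_sum horner_coef; apply: eq_bigr => t _.
  by rewrite rmorphMn hornerMn -Pw -natrX mulr_natr.
move=> n z zq; rewrite rmorph_sum horner_sum (le_trans (ler_norm_sum _ _ _))//.
rewrite mulr_suml rmorph_sum /=; apply: ler_sum => t _.
rewrite rmorphMn hornerMn normrMn -[leLHS]mulr_natr rmorphM /= ler_pM//; first exact: (HA t).2.
have -> : (n.+1%:R ^+ size P)%:C%C = n.+1%:R ^+ size P :> R[i].
  by rewrite rmorphXn rmorph_nat.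
rewrite natrX (@le_trans _ _ (n.+1%:R ^+ t))//.
  by rewrite lerXn2r ?nnegrE// ler_nat.
by rewrite ler_weXn2l ?ler1n// ltnW.
Qed.

End Gap.

(** * Regrouping by exponent *)

Section Scatter.
Variable R : realType.
Implicit Types (q : R) (h : nat -> R).
Local Open Scope classical_set_scope.
Local Open Scope ring_scope.

(** This is the coefficient of 1 / q^k once equal exponents are collected. The cutoff n <= k keeps
    the sum finite and loses nothing when [n <= e n]. *)
Definition scatter (V : zmodType) (e : nat -> nat) (h : nat -> V) (k : nat) : V :=
  \sum_(1 <= n < k.+1 | e n == k) h n.

Lemma scatter_partial q h (e : nat -> nat) N : 0 < q ->
  (forall n, (0 < n)%N -> (n <= e n)%N) ->
  \sum_(0 <= k < N) scatter e h k / q ^+ k =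
  \sum_(1 <= n < N | (e n < N)%N) h n / q ^+ e n.
Proof.
move=> q0 He.
transitivity (\sum_(0 <= k < N) \sum_(1 <= n < N) if e n == k then h n / q ^+ k else 0).
  apply: eq_big_nat => k kN; rewrite /scatter mulr_suml big_mkcond /=.
  rewrite [RHS](big_cat_nat (n := k.+1)) //=.
  rewrite [X in _ = _ + X]big_nat_cond [X in _ = _ + X]big1 ?addr0//; last first.
    move=> n /andP[hn _]; case: eqP => // en; exfalso; have /He : (0 < n)%N by lia.
    by move: en hn; clear; lia.
rewrite exchange_big_nat /= [RHS]big_mkcond /=; apply: eq_big_nat => n nN.
case: ltnP => en.
  rewrite (bigD1_seq (e n)) ?iota_uniq ?mem_index_iota//= eqxx big1 ?addr0//.
  by move=> k; rewrite eq_sym => /negPf ->.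
rewrite big_nat_cond big1// => k /andP[kN _]; case: eqP => // ek; exfalso.
by move: kN ek en; clear; lia.
Qed.

(** The two partial sums differ only by terms with n < N <= e n: fewer than N of them, each at most
    a power of N + 1 divided by [q ^+ N]. *)
Lemma scatter_series q h (e : nat -> nat) (A : R) K : 1 < q ->
  (forall n, (0 < n)%N -> (n <= e n)%N) -> 0 <= A ->
  (forall n, `|h n| <= A * n.+1%:R ^+ K) ->
  exists S : R,
    (fun N => \sum_(1 <= n < N) h n / q ^+ e n) @ \oo --> S /\
    (fun N => \sum_(0 <= k < N) scatter e h k / q ^+ k) @ \oo --> S.
Proof.
move=> q1 He A0 HA; have q0 : 0 < q by apply: lt_trans q1.
have qn n : 0 < q ^+ n by rewrite exprn_gt0.
pose u n := if n == 0%N then 0 else h n / q ^+ e n.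
have uE N : \sum_(1 <= n < N) h n / q ^+ e n = series u N.
  case: N => [|N]; first by rewrite /series /= !big_geq.
  rewrite /series /= [RHS]big_ltn// [u 0%N]/= add0r.
  by apply: eq_big_nat => -[].
pose v n := A * (n.+1%:R ^+ K / q ^+ n).
have uv n : `|u n| <= v n.
  rewrite /u /v; case: eqP => [->|/eqP n0]; first by rewrite normr0 mulr_ge0 ?divr_ge0.
  rewrite normrM normfV (gtr0_norm (qn _)) [leRHS]mulrA ler_pM ?invr_ge0 ?(ltW (qn _))//.
  by rewrite lef_pV2 ?posrE// ler_eXn2l// He// lt0n.
have vcvg : cvgn (series v).
  have [T T0 HT] := expr_tail_bound K q1.
  apply: nondecreasing_is_cvgn.
    apply: nondecreasing_series => n _ _.
    by rewrite mulr_ge0// divr_ge0// ltW.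
  exists (A * T) => _ [N _ <-]; rewrite /series /= -mulr_sumr ler_wpM2l//.
  by rewrite (le_trans (HT 0%N N))// expr1n expr0 divr1 mulr1.
have ucvg : cvgn (series u).
  apply: normed_cvg; apply: series_le_cvg vcvg => n //=.
  by rewrite mulr_ge0// divr_ge0// ltW.
exists (limn (series u)).
have US : (fun N => \sum_(1 <= n < N) h n / q ^+ e n) @ \oo --> limn (series u).
  by rewrite (_ : (fun _ => _) = series u)//; apply/funext => N.
split => //.
pose s := Num.sqrt q; have sE : s ^+ 2 = q by rewrite sqr_sqrtr// ltW.
have s1 : 1 < s by rewrite -sqrtr1 ltr_sqrt.
have s0 : 0 < s by apply: lt_trans s1.
have [C C0 HC] := expr_dominates K.+1 s1.
pose w N := A * C * (s^-1) ^+ N.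
have w0 : w @ \oo --> (0 : R).
  rewrite -(mulr0 (A * C)); apply: cvgMr; apply: cvg_expr.
  by rewrite ger0_norm ?invr_ge0 ?ltW// invf_lt1.
have diff N : `|\sum_(1 <= n < N | ~~ (e n < N)%N) h n / q ^+ e n| <= w N.
  rewrite (le_trans (ler_norm_sum _ _ _))//.
  apply: (@le_trans _ _ (\sum_(0 <= n < N) A * N.+1%:R ^+ K / q ^+ N)).
    case: N => [|N]; first by rewrite !big_geq.
    rewrite [leRHS]big_nat_recl//= big_add1 /= ler_wpDl ?divr_ge0 ?mulr_ge0 ?exprn_ge0 ?(ltW q0)//.
    rewrite big_mkcond big_nat_cond [leRHS]big_nat_cond; apply: ler_sum => n /andP[hn _].
    case: ifP => [|_]; last by rewrite divr_ge0 ?mulr_ge0 ?exprn_ge0 ?(ltW q0).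
    rewrite -leqNgt => en; rewrite normrM normfV (gtr0_norm (qn _)).
    rewrite ler_pM ?invr_ge0 ?(ltW (qn _))//.
      rewrite (le_trans (HA _))// ler_wpM2l// lerXn2r ?nnegrE// ler_nat; lia.
    by rewrite lef_pV2 ?posrE// ler_eXn2l.
  rewrite sumr_const_nat subn0 /w -[leLHS]mulr_natl -!mulrA mulrCA ler_wpM2l//.
  apply: (@le_trans _ _ (N.+1%:R ^+ K.+1 / q ^+ N)).
    rewrite exprS -mulrA ler_wpM2r ?divr_ge0 ?exprn_ge0 ?(ltW q0)//.
    by rewrite ler_nat.
  rewrite ler_pdivrMr// (le_trans (HC N))//.
  by rewrite -sE -exprM mulnC exprM expr2 exprVn -!mulrA mulKf ?lexx// expf_neq0// gt_eqF.
rewrite (_ : (fun _ => _) = (fun N => \sum_(1 <= n < N) h n / q ^+ e n -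
    \sum_(1 <= n < N | ~~ (e n < N)%N) h n / q ^+ e n)); last first.
  apply/funext => N; rewrite scatter_partial//.
  by rewrite [in RHS](bigID (fun n => (e n < N)%N)) /= addrK.
rewrite -[X in _ --> X]subr0; apply: cvgB => //.
apply/cvgr0Pnorm_lt => eps eps0.
move/cvgr0Pnorm_lt : w0 => /(_ _ eps0); apply: filterS => N hN.
by apply: le_lt_trans (diff N) (le_lt_trans _ hN); exact: ler_norm.
Qed.

End Scatter.

(** * Collected coefficients as values of [ptilde] *)

Section Local.
Local Open Scope classical_set_scope.
Local Open Scope ring_scope.

Lemma nbhs_infty_ger_rat (r : rat) : \forall n \near \oo, r <= n%:R.
Proof.
exists (Num.truncn r).+1 => // n /= hn.
by rewrite ltW// (lt_le_trans (truncnS_gt r))// ler_nat.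
Qed.

Lemma near_poly_gt (g : {poly rat}) d (c : rat) : size g = d.+2 -> 0 < lead_coef g ->
  \forall x \near \oo, c < g.[x%:R].
Proof.
move=> sg lg; have [U U1 HU] := poly_lower sg lg.
apply: (near_mp (nbhs_infty_ger_rat U)).
apply: (near_mp (nbhs_infty_ger_rat (2 * `|c| / lead_coef g + 1))).
apply: nearW => x hx xU; apply: lt_le_trans (HU _ xU).
have x1 : 1 <= x%:R :> rat by apply: le_trans U1 xU.
apply: (@lt_le_trans _ _ (lead_coef g / 2 * x%:R)); last first.
  by rewrite ler_pM2l ?divr_gt0// -[leLHS]expr1 ler_weXn2l.
have : 2 * `|c| / lead_coef g < x%:R by lra.
rewrite ltr_pdivrMr// => h.
by have := ler_norm c; lra.
Qed.

(** [g] need not be monotone at small or negative arguments; the lower bound [Y] leaves finitely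
    many of those, and their values are exceeded by that of a large x. *)
Lemma near_poly_inj (g : {poly rat}) d (Y : int) : size g = d.+2 -> 0 < lead_coef g ->
  \forall x \near \oo, forall y : int, Y <= y -> g.[y%:~R] = g.[x%:R] -> y = x%:Z.
Proof.
move=> sg lg; have [c c0 [U U1 HU]] := poly_increment sg lg.
have [N hN] := archi_nat_ge U.
pose N' := (N + absz Y)%N.
have fin : \forall x \near \oo, forall i : 'I_N', g.[(Y + i%:Z)%:~R] < g.[x%:R].
  by apply: filter_forall => i; apply: near_poly_gt sg lg.
apply: (near_mp fin); apply: (near_mp (nbhs_infty_ge N)); apply: nearW => x Nx {}fin y Yy E.
have strict (u v : rat) : U <= v -> v < u -> g.[v] < g.[u].
  move=> Uv vu; rewrite -subr_gt0; apply: lt_le_trans (HU _ _ Uv (ltW vu)).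
  by rewrite !mulr_gt0 ?subr_gt0// exprn_gt0// (lt_le_trans _ (le_trans U1 Uv)).
have xU : U <= x%:R by rewrite (le_trans hN)// ler_nat.
case: (leP N%:Z y) => Ny; last first.
  have hi : (absz (y - Y)%R < N')%N by rewrite /N'; move: Yy Ny; clear; lia.
  have := fin (Ordinal hi); rewrite /= (_ : Y + `|y - Y|%N = y) ?E ?ltxx//.
  by move: Yy; clear; lia.
have yU : U <= y%:~R by rewrite (le_trans hN)// pmulrn ler_int.
have [yx|xy|//] := ltgtP y x%:Z.
- have := strict x%:R y%:~R yU; rewrite pmulrn ltr_int => /(_ yx).
  by rewrite E -pmulrn ltxx.
- have := strict y%:~R x%:R xU; rewrite pmulrn ltr_int => /(_ xy).
  by rewrite E -pmulrn ltxx.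
Qed.

Variable R : realType.
Variables (g F : {poly rat}) (d : nat) (B C : int) (E0 : nat) (e : nat -> nat).
Hypotheses (sg : size g = d.+2) (lg : 0 < lead_coef g) (B0 : 0 < B).
Hypothesis gF : forall u : rat, g.[B%:~R * u - C%:~R] = F.[u].
Hypothesis eF : forall n, (0 < n)%N -> (e n)%:R = F.[n%:R] + E0%:R :> rat.
Hypothesis en : forall n, (0 < n)%N -> (n <= e n)%N.

Lemma exponent_eq (n k x : nat) : (0 < n)%N -> k%:R = g.[x%:R] + E0%:R ->
  (e n == k) = (g.[(B * n%:Z - C)%:~R] == g.[x%:R]).
Proof.
move=> n0 kE; rewrite -(eqr_nat rat) eF// kE (inj_eq (addIr _)) -gF.
by rewrite rmorphB rmorphM /= -pmulrn.
Qed.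

(** By injectivity of [g] at large arguments, [e n = k] means B n - C = x. Such an n exists exactly
    when x is in the residue class that [ptilde] selects, and it is unique. All n >= 1 satisfy B n -
    C >= B - C, whence the bound passed to [near_poly_inj]. *)
Lemma scatter_ptilde : \forall x \near \oo, forall (k : nat) (P : {poly R}),
  k%:R = g.[x%:R] + E0%:R -> scatter e (fun n => P.[n%:R]) k = ptilde P B C x.
Proof.
apply: (near_mp (near_poly_inj (B - C) sg lg)).
apply: (near_mp (nbhs_infty_ge (absz C).+1)); apply: nearW => x xC inj k P kE.
have eqn n : (0 < n)%N -> (e n == k) = (B * n%:Z - C == x%:Z).
  move=> n0; rewrite (exponent_eq n0 kE); apply/eqP/eqP => [h|->]; last by [].
  by apply: inj => //; move: n0 B0; clear; nia.
rewrite /ptilde eqz_mod_dvd opprK; case: ifPn => [/dvdzP[z zE]|ndvd].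
  have z0 : 0 < z by move: xC zE B0; clear; nia.
  have [n nE] : exists n : nat, z = n%:Z by exists (absz z); move: z0; clear; lia.
  have n0 : (0 < n)%N by move: z0; rewrite nE.
  have enk : e n == k by rewrite eqn// -nE; apply/eqP; move: zE; clear; lia.
  rewrite /scatter big_mkcond (bigD1_seq n) ?iota_uniq//=; last first.
    by rewrite mem_index_iota n0 /= ltnS -(eqP enk) en.
  rewrite enk big_seq_cond big1 ?addr0 => [|n']; last first.
    rewrite mem_index_iota => /andP[/andP[n'0 _] n'n]; case: ifP => //.
    rewrite eqn// => /eqP h; case/eqP: n'n; move: h zE B0; rewrite nE; clear; nia.
  congr (P.[_]); rewrite zE nE rmorphM /= -pmulrn mulfK//.
  by rewrite intr_eq0 gt_eqF.
rewrite /scatter big_nat_cond big1// => n /andP[/andP[n0 _]]; rewrite eqn// => /eqP h.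
case/negP: ndvd; apply/dvdzP; exists n%:Z; move: h; clear; lia.
Qed.

(** A large exponent forces a large n, because the n below [N0] reach only finitely many exponents;
    from [N0] on, x = B n - C is at least [X0]. *)
Lemma scatter_support (X0 : nat) : exists K0 : nat, forall (k : nat) (P : {poly R}),
  (K0 <= k)%N -> scatter e (fun n => P.[n%:R]) k != 0 ->
  exists2 x : nat, (X0 <= x)%N & k%:R = g.[x%:R] + E0%:R.
Proof.
pose N0 := (absz C + X0)%N.
exists (\sum_(n < N0) e n).+1 => k P Kk nz.
have [n [n0 enk]] : exists n, (0 < n)%N /\ e n = k.
  apply: contrapT => H; case/eqP: nz; rewrite /scatter big_nat_cond big1//.
  by move=> n /andP[/andP[n0 _] /eqP enk]; case: H; exists n.
have Nn : (N0 <= n)%N.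
  rewrite leqNgt; apply/negP => nN; move: Kk; rewrite -enk.
  by rewrite (bigD1 (Ordinal nN))//=; set S := (\sum_(i < N0 | _) _)%N; move: S; clear; lia.
have [x xE] : exists x : nat, B * n%:Z - C = x%:Z.
  exists (absz (B * n%:Z - C)%R); move: Nn B0; rewrite /N0; clear; nia.
exists x; first by move: Nn B0 xE; rewrite /N0; clear; nia.
rewrite -enk eF// -gF; congr (_.[_] + _).
by rewrite [n%:R]pmulrn -rmorphM /= -rmorphB /= xE -pmulrn.
Qed.

End Local.

(** * The field Q(q) and the common forms *)

Section Adjoin.
Variables (R : realType) (q : R).

Notation ev a := ((map_poly (ratr : rat -> R) a).[q]).

Let evM a b : ev (a * b) = ev a * ev b.
Proof. by rewrite rmorphM hornerM. Qed.

Let evD a b : ev (a + b) = ev a + ev b.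
Proof. by rewrite rmorphD hornerD. Qed.

Let evZ c a : ev (c *: a) = ratr c * ev a.
Proof. by rewrite map_polyZ hornerZ. Qed.

Lemma Qadjoin_poly (a : {poly rat}) : in_Qadjoin q (ev a).
Proof. by exists a, 1; rewrite rmorph1 hornerC oner_neq0 divr1. Qed.

Lemma Qadjoin_rat (r : rat) : in_Qadjoin q (ratr r).
Proof. by have := Qadjoin_poly r%:P; rewrite map_polyC hornerC. Qed.

Lemma Qadjoin0 : in_Qadjoin q 0.
Proof. by rewrite -(rmorph0 (ratr : {rmorphism rat -> R})); exact: Qadjoin_rat. Qed.

Lemma Qadjoin_nat n : in_Qadjoin q n%:R.
Proof. by rewrite -(ratr_nat R n); exact: Qadjoin_rat. Qed.

Lemma Qadjoin_gen : in_Qadjoin q q.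
Proof. by have := Qadjoin_poly 'X; rewrite map_polyX hornerX. Qed.

Lemma QadjoinD x y : in_Qadjoin q x -> in_Qadjoin q y -> in_Qadjoin q (x + y).
Proof.
move=> [a [b [b0 ->]]] [c [d [d0 ->]]]; exists (a * d + c * b), (b * d).
rewrite evD !evM; split; first exact: mulf_neq0.
by field; rewrite b0 d0.
Qed.

Lemma QadjoinM x y : in_Qadjoin q x -> in_Qadjoin q y -> in_Qadjoin q (x * y).
Proof.
move=> [a [b [b0 ->]]] [c [d [d0 ->]]]; exists (a * c), (b * d).
by rewrite !evM mulf_div; split=> //; exact: mulf_neq0.
Qed.

Lemma QadjoinV x : in_Qadjoin q x -> in_Qadjoin q x^-1.
Proof.
move=> [a [b [b0 ->]]]; have [a0|a0] := eqVneq (ev a) 0.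
  by rewrite a0 mul0r invr0; exact: Qadjoin0.
by exists b, a; rewrite invf_div.
Qed.

Lemma QadjoinN x : in_Qadjoin q x -> in_Qadjoin q (- x).
Proof.
move=> hx; rewrite -mulN1r; apply: QadjoinM => //.
by have := Qadjoin_rat (-1); rewrite rmorphN rmorph1.
Qed.

Lemma QadjoinX x n : in_Qadjoin q x -> in_Qadjoin q (x ^+ n).
Proof.
move=> hx; elim: n => [|n IH]; first by rewrite expr0 -[1]/(1%:R); exact: Qadjoin_nat.
by rewrite exprS; apply: QadjoinM.
Qed.

Lemma QadjoinXz (z : int) : in_Qadjoin q (q ^ z).
Proof.
case: z => n; first exact: QadjoinX Qadjoin_gen.
by rewrite NegzE -invr_expz; apply: QadjoinV; exact: QadjoinX Qadjoin_gen.
Qed.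

Lemma Qadjoin_sum (I : Type) (r : seq I) (Q : pred I) (x : I -> R) :
  (forall i, in_Qadjoin q (x i)) -> in_Qadjoin q (\sum_(i <- r | Q i) x i).
Proof.
move=> H; elim/big_ind: _ => //; [exact: Qadjoin0 | exact: QadjoinD].
Qed.

Lemma Qadjoin_horner (P : {poly R}) x : (forall t, in_Qadjoin q P`_t) ->
  in_Qadjoin q x -> in_Qadjoin q P.[x].
Proof.
move=> HP hx; rewrite horner_coef; apply: Qadjoin_sum => t.
by apply: QadjoinM => //; apply: QadjoinX.
Qed.

(** A denominator that does not vanish at [q] is coprime to the minimal polynomial, so Bezout
    inverts it within Q[q]; an integer then clears the rational coefficients. *)
Lemma Qadjoin_denominator x : algebraic_integer q -> in_Qadjoin q x ->
  exists2 D : int, D != 0 &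
    exists w : {poly int}, D%:~R * x = (map_poly intr w).[q].
Proof.
move=> qint [a [b [b0 ->]]].
have [p [pm pq irr]] := algebraic_integer_minpoly qint.
have cop : coprimep (map_poly intr p) b.
  apply: contraT => /(irreducible_coprime irr) /dvdpP[s sE].
  by case/eqP: b0; rewrite sE evM map_ratr_intr (rootP pq) mulr0.
have [[u v] /= /eqpP[[c1 c2] /= /andP[c10 c20] uvE]] := Bezout_coprimepP _ _ cop.
have vb : ratr c1 * (ev v * ev b) = ratr c2.
  have := congr1 (fun s => ev s) uvE.
  rewrite /= !evZ evD !evM map_ratr_intr.
  by rewrite (rootP pq) mulr0 add0r rmorph1 hornerC mulr1.
have c1R : ratr c1 != 0 :> R by rewrite fmorph_eq0.
have c2R : ratr c2 != 0 :> R by rewrite fmorph_eq0.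
have xE : ev a / ev b = ev ((c1 / c2) *: (a * v)).
  have v0 : ev v != 0.
    by move: c2R; rewrite -vb !mulf_eq0 !negb_or => /and3P[].
  by rewrite evZ evM fmorph_div /= -vb; field; rewrite b0 v0 c1R.
have [w [D D0 wE]] := rat_poly_scale ((c1 / c2) *: (a * v)).
exists D => //; exists w; rewrite xE wE evZ map_ratr_intr fmorphV /= ratr_int mulrA.
by rewrite mulfV ?mul1r// intr_eq0.
Qed.

Lemma common_multiplier (I : finType) (Q : I -> int -> Prop) :
  (forall i D D', Q i D -> Q i (D' * D)) ->
  (forall i, exists2 D, D != 0 & Q i D) -> exists2 D, D != 0 & forall i, Q i D.
Proof.
move=> QM H; have {}H i : exists D, D != 0 /\ Q i D by have [D] := H i; exists D.
have [D HD] := choice H; exists (\prod_i D i).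
  by apply/prodf_neq0 => i _; exact: (HD i).1.
by move=> i; rewrite (bigD1 i)//= mulrC; apply: QM; exact: (HD i).2.
Qed.

Lemma integral_multiple (D D' : int) (x : R) :
  (exists w : {poly int}, D%:~R * x = (map_poly intr w).[q]) ->
  exists w : {poly int}, (D' * D)%:~R * x = (map_poly intr w).[q].
Proof.
move=> [w wE]; exists (D' *: w).
by rewrite map_polyZ /= hornerZ -wE intrM mulrA.
Qed.

Lemma Qadjoin_poly_denominator (P : {poly R}) : algebraic_integer q ->
  (forall t, in_Qadjoin q P`_t) -> exists2 D : int, D != 0 &
    forall t, exists w : {poly int}, D%:~R * P`_t = (map_poly intr w).[q].
Proof.
move=> qint HP.
have [||D D0 HD] := @common_multiplier 'I_(size P)
  (fun t D => exists w : {poly int}, D%:~R * P`_t = (map_poly intr w).[q]).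
- by move=> t D D'; exact: integral_multiple.
- by move=> t; exact: Qadjoin_denominator.
exists D => // t; have [tP|tP] := ltnP t (size P); first exact: (HD (Ordinal tP)).
by exists 0; rewrite rmorph0 horner0 nth_default// mulr0.
Qed.

End Adjoin.

(** Starting from f_0(x) = f_j(b_j x + c_j) + d_j, put g(x) = f_0(x / M). This has the required form
    with B_j = M / b_j and C_j = c_j M / b_j, so [M] only has to make these numbers integers. *)
Lemma common_form_exists n (f : 'I_n -> {poly rat}) : (0 < n)%N ->
  (forall j1 j2, poly_sim (f j1) (f j2)) ->
  exists (g : {poly rat}) (B C D : 'I_n -> int), common_form f g B C D.
Proof.
case: n f => // n f _ sim.
have H j : exists bcd : rat * rat * int, 0 < bcd.1.1 /\
    f ord0 = f j \Po (bcd.1.1 *: 'X + bcd.1.2%:P) + (bcd.2%:~R)%:P.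
  by have [b [c [d [h1 h2]]]] := sim ord0 j; exists (b, c, d).
have [s Hs] := choice H.
pose b j := (s j).1.1; pose c j := (s j).1.2; pose d j := (s j).2.
have b0 j : 0 < b j by exact: (Hs j).1.
have [||N N0 HN] := @common_multiplier 'I_n.+1 (fun j N =>
  N%:~R / b j \is a Num.int /\ c j * N%:~R / b j \is a Num.int).
- move=> j N N' [h1 h2]; rewrite intrM -!mulrA; split; first by rewrite rpredM// intr_int.
  by rewrite mulrCA rpredM ?intr_int// mulrA.
(* Dividing [numq (b j)] by [b j] leaves [denq (b j)], and [denq (c j)] clears [c j]. *)
- move=> j; exists (numq (b j) * denq (c j)).
    by rewrite mulf_neq0 ?denq_neq0// numq_eq0 gt_eqF.
  have bE : (numq (b j))%:~R / b j = (denq (b j))%:~R.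
    by rewrite numqE mulrAC mulfV ?mul1r// gt_eqF.
  split; rewrite intrM.
    by rewrite mulrAC bE rpredM ?intr_int.
  rewrite (_ : _ / _ = (numq (b j))%:~R / b j * (c j * (denq (c j))%:~R)).
    by rewrite bE -numqE rpredM ?intr_int.
  by field; rewrite (gt_eqF (b0 j)).
have [M M0 HM] : exists2 M : int, 0 < M & forall j,
    M%:~R / b j \is a Num.int /\ c j * M%:~R / b j \is a Num.int.
  exists `|N|; first by rewrite normr_gt0.
  move=> j; have [h1 h2] := HN j; case: (ger0P N) => _ //.
  by rewrite intrN mulrN !mulNr !rpredN.
have HB j : exists z : int, M%:~R / b j = z%:~R by have /intrP := (HM j).1.
have HC j : exists z : int, c j * M%:~R / b j = z%:~R by have /intrP := (HM j).2.
have [B BE] := choice HB; have [C CE] := choice HC.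
have MQ : M%:~R != 0 :> rat by rewrite intr_eq0 gt_eqF.
exists (f ord0 \Po (M%:~R^-1 *: 'X)), B, C, d => j.
have Bj : 0 < (B j)%:~R :> rat by rewrite -BE divr_gt0// ltr0z.
split; first by rewrite ltr0z in Bj.
rewrite [in LHS](Hs j).2 comp_polyD comp_polyC -comp_polyA; congr (_ \Po _ + _).
rewrite comp_polyD comp_polyZ comp_polyX comp_polyC scalerA -BE -CE scalerDr.
have bn : b j != 0 by rewrite gt_eqF.
congr (_ *: 'X + _); rewrite -/(b j) -/(c j); first by field; rewrite MQ bn.
by rewrite -[RHS]mul_polyC -polyCM; congr (_%:P); field; rewrite MQ bn.
Qed.

Lemma common_form_sim n1 n2 (f1 : 'I_n1 -> {poly rat}) (f2 : 'I_n2 -> {poly rat})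
    g1 g2 B1 C1 D1 B2 C2 D2 j1 j2 :
  common_form f1 g1 B1 C1 D1 -> common_form f2 g2 B2 C2 D2 ->
  poly_sim g1 g2 -> poly_sim (f1 j1) (f2 j2).
Proof.
move=> /(_ j1)[b1 e1] /(_ j2)[b2 e2] [b [c [d [b0 gE]]]].
have B1n : (B1 j1)%:~R != 0 :> rat by rewrite intr_eq0 gt_eqF.
have B2n : (B2 j2)%:~R != 0 :> rat by rewrite intr_eq0 gt_eqF.
exists (b * (B1 j1)%:~R / (B2 j2)%:~R),
  ((c + (C2 j2)%:~R - b * (C1 j1)%:~R) / (B2 j2)%:~R), (d + D2 j2 - D1 j1).
split; first by rewrite divr_gt0 ?mulr_gt0 ?ltr0z.
have -> : f1 j1 = (g1 - ((D1 j1)%:~R)%:P) \Po ((B1 j1)%:~R *: 'X - ((C1 j1)%:~R)%:P).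
  rewrite e1 addrK -comp_polyA comp_polyZ comp_polyD comp_polyX comp_polyC.
  by rewrite subrK scalerA mulVf// scale1r comp_polyXr.
rewrite gE e2 !(comp_polyB, comp_polyD, comp_polyC) -!comp_polyA -!addrA.
congr (_ \Po _ + _); last first.
  by rewrite !intrD intrN !polyCD polyCN addrCA addrA.
rewrite !(comp_polyZ, comp_polyD, comp_polyC, comp_polyX, scalerDr, scalerBr, scalerA, comp_polyB).
rewrite -!mul_polyC -!polyCM -!addrA; congr (_ + _).
  by congr (_%:P * _); field.
by rewrite -!polyCN -!polyCD -polyCM -polyCD; congr (_%:P); field.
Qed.

(** [F - X] keeps a positive leading coefficient, so it can be negative only at finitely many n, and
    [E] outweighs all of those. *)
Lemma integer_shift (F : {poly rat}) d : size F = d.+3 -> 0 < lead_coef F ->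
  exists E : nat, forall n : nat, n%:R <= F.[n%:R] + E%:R.
Proof.
move=> sF lF; pose G := F - 'X.
have sX : (size (- 'X : {poly rat}) < size F)%N by rewrite size_polyN size_polyX sF.
have sG : size G = d.+3 by rewrite size_polyDl// sF.
have lG : 0 < lead_coef G by rewrite lead_coefDl.
have [N _ HN] := near_poly_gt 0 sG lG.
pose E := (\sum_(n < N) (Num.truncn `|G.[n%:R]|).+1)%N.
exists E => n; rewrite -subr_ge0 addrAC.
have -> : F.[n%:R] - n%:R = G.[n%:R] by rewrite /G !hornerE.
have [Nn|nN] := leqP N n.
  by rewrite addr_ge0// ltW//; apply: HN.
have h1 : `|G.[n%:R]| <= E%:R.
  apply: (@le_trans _ _ (Num.truncn `|G.[n%:R]|).+1%:R); first by rewrite ltW// truncnS_gt.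
  by rewrite ler_nat /E (bigD1 (Ordinal nN))//= leq_addr.
by have := lerNnormlW h1; lra.
Qed.

Lemma nat_sqrt_exists x : exists w, (w ^ 2 <= x < w.+1 ^ 2)%N.
Proof.
elim: x => [|x [w /andP[h1 h2]]]; first by exists 0%N.
have [h|h] := ltnP x.+1 (w.+1 ^ 2); first by exists w; rewrite h andbT (leq_trans h1).
exists w.+1; rewrite h /= (leq_ltn_trans h2)//.
by rewrite ltn_exp2r.
Qed.

(** * Window length, gaps within one class, and progressions *)

Section SpacingAny.
Local Open Scope classical_set_scope.
Local Open Scope ring_scope.

Lemma spacing (R : realType) (g h : {poly rat}) t : (2 < size g)%N ->
  (size g <= size h)%N -> 0 < lead_coef g -> 0 < lead_coef h -> (0 < t)%N ->
  ~ poly_sim g h ->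
  \forall x \near \oo, forall (y1 y2 w : nat), (w ^ 2 <= 2 * x)%N ->
    `|g.[x%:R] - h.[y1%:R]| <= w%:R -> `|g.[(x + t)%:R] - h.[y2%:R]| <= w%:R ->
    g.[x%:R] - h.[y1%:R] \is a Num.int -> False.
Proof.
move=> g3 gh lg lh t0 nsim.
have [d sg] : exists d, size g = d.+3.
  by exists (size g - 3)%N; rewrite -{1}(subnKC g3).
have [d' sh] : exists d', size h = d'.+3.
  by exists (size h - 3)%N; rewrite -{1}(subnKC (leq_trans g3 gh)).
have : (d <= d')%N by move: gh; rewrite sg sh.
rewrite leq_eqVlt => /predU1P[dd|dd].
  by rewrite -dd in sh; exact: (@spacing_eq_degree R _ _ d).
have H := @spacing_lt_degree R (map_poly ratr g) (map_poly ratr h) d d' t.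
rewrite !size_map_poly !lead_coef_map !ltr0q in H.
apply: (near_mp (H sg sh dd lg lh t0)); apply: nearW => x Hx y1 y2 w hw h1 h2 _.
apply: (Hx y1 y2 w%:R); [|exact: dist_ratr_nat|exact: dist_ratr_nat].
by rewrite -natrX -natrM ler_nat.
Qed.

Lemma window_exponential (R : realType) (q : R) (g : {poly rat}) (E0 : nat) (A : R) K :
  1 < q -> 0 < A -> \forall x \near \oo, forall w e : nat,
    (w ^ 2 <= x < w.+1 ^ 2)%N -> e%:R = g.[x%:R] + E0%:R ->
    A * (2 * e).+2%:R ^+ K < q ^+ w.
Proof.
move=> q1 A0; have [A1 A10 HA1] := poly_bound_ge1 g.
have [N1 hN1] := archi_nat_ge A1.
pose n := size g; pose M := (2 * (N1 + E0) + 2)%N.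
(* The exponent carries one spare power: since x < (w + 1)^2, the other 2 n K powers dominate
   [(2 * e).+2 ^ K] up to a constant, and the extra factor w + 1 exceeds the constant [c] once x >
   N2^2. *)
have [Cc C0 HC] := expr_dominates (2 * n * K).+1 q1.
pose c := A * M%:R ^+ K * Cc.
have [N2 hN2] := archi_nat_ge c.
apply: (near_mp (nbhs_infty_ge (N2 ^ 2).+1)); apply: nearW => x hx w e /andP[_ xw] eE.
have wN : (N2 < w.+1)%N.
  by rewrite -(ltn_exp2r _ _ (isT : 0 < 2)%N) (leq_trans hx)// ltnW.
have x0 : (0 < x)%N by apply: leq_trans hx.
have e1 : (e <= (N1 + E0) * x ^ n)%N.
  rewrite -(ler_nat rat) eE natrM natrD mulrDl natrX lerD//.
    have := HA1 n x%:R; rewrite leqnSn ler1n x0 => /(_ isT isT) /ler_normlW h.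
    by rewrite (le_trans h)// ler_wpM2r// exprn_ge0.
  by rewrite -natrX -natrM ler_nat leq_pmulr// expn_gt0 x0.
have e2 : ((2 * e).+2 <= M * w.+1 ^ (2 * n))%N.
  apply: (@leq_trans (M * x ^ n)).
    have : (0 < x ^ n)%N by rewrite expn_gt0 x0.
    rewrite /M; move: e1; move: (x ^ n)%N => X; clear; nia.
  rewrite leq_mul2l expnM; apply/orP; right.
  by have [->//|n0] := posnP n; rewrite leq_exp2r// ltnW.
have q0 : 0 < q by apply: lt_trans q1.
have w0 : 0 < w.+1%:R :> R by [].
rewrite -(ltr_pM2r w0).
apply: (@le_lt_trans _ _ (A * M%:R ^+ K * w.+1%:R ^+ (2 * n * K).+1)).
  rewrite exprSr mulrA ler_pM2r// -mulrA ler_pM2l// exprM -exprMn.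
  by rewrite lerXn2r ?nnegrE// ?mulr_ge0 ?exprn_ge0// -natrX -natrM ler_nat.
apply: (@le_lt_trans _ _ (c * q ^+ w)).
  rewrite /c -[leRHS]mulrA; apply: ler_wpM2l; last exact: HC.
  by rewrite mulr_ge0 ?exprn_ge0// ltW.
rewrite mulrC ltr_pM2l ?exprn_gt0// (le_lt_trans hN2)//.
by rewrite ltr_nat.
Qed.

(** Degree at least 2 makes neighbouring values near x differ by order x, which is more than a
    window; [Y] marks where [g] has become increasing. *)
Lemma near_gap (R : realType) (g : {poly rat}) : (2 < size g)%N -> 0 < lead_coef g ->
  exists Y : nat, \forall x \near \oo, forall y w : nat, (Y <= y)%N -> y <> x ->
    (w ^ 2 <= x)%N -> w%:R < `|g.[y%:R] - g.[x%:R]|.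
Proof.
move=> g3 lg.
have [d sg] : exists d, size g = d.+3.
  by exists (size g - 3)%N; rewrite -{1}(subnKC g3).
have [c c0 [U U1 HU]] := poly_increment sg lg.
have [Y hY] := archi_nat_ge U.
exists Y.
(* The half allows the increment to start at x - 1, which is at least x / 2. *)
have cR : 0 < ratr (c / 2) :> R by rewrite ltr0q divr_gt0.
apply: (near_mp (window_small 0 cR)); apply: (near_mp (nbhs_infty_ge Y.+2)); apply: nearW.
move=> x hx hwin y w Yy yx hw.
have w1 : w%:R < c / 2 * x%:R.
  have h : (w%:R : R) < ratr (c / 2) * x%:R.
    have := hwin w%:R; rewrite add0r; apply.
    by rewrite -natrX -natrM ler_nat (leq_trans hw)// leq_pmull.
  by rewrite -(ltr_rat R) (rmorphM _ (c / 2)) /= !ratr_nat.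
have inc (u v : nat) : (Y <= v)%N -> (v < u)%N -> (x.-1 <= v)%N ->
    w%:R < g.[u%:R] - g.[v%:R].
  move=> Yv vu xv; have Uv : U <= v%:R by rewrite (le_trans hY)// ler_nat.
  apply: lt_le_trans (HU _ _ Uv _); last by rewrite ler_nat ltnW.
  apply: (lt_le_trans w1).
  have v1 : 1 <= v%:R :> rat by apply: le_trans Uv.
  apply: (@le_trans _ _ (c * v%:R)).
    rewrite -mulrA ler_pM2l// mulrC ler_pdivrMr// -natrM ler_nat; move: xv hx; clear; lia.
  rewrite -mulrA ler_pM2l// -natrB ?(ltnW vu)//.
  apply: (@le_trans _ _ (v%:R ^+ d.+1)); first by rewrite -[leLHS]expr1 ler_weXn2l.
  by rewrite ler_peMl ?exprn_ge0// ler1n subn_gt0.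
have [xy|yltx|xyE] := ltngtP x y; last by case: yx.
  by apply: lt_le_trans (ler_norm _); apply: inc => //; [|exact: leq_pred]; move: hx; clear; lia.
rewrite distrC; apply: lt_le_trans (ler_norm _).
have h1 : w%:R < g.[x%:R] - g.[x.-1%:R].
  by apply: inc => //; move: hx; clear; lia.
apply: lt_le_trans h1 _; rewrite lerD2l lerN2 -subr_ge0.
have yU : U <= y%:R by rewrite (le_trans hY)// ler_nat.
apply: le_trans (HU _ _ yU _); last by rewrite ler_nat; move: yltx; clear; lia.
rewrite !mulr_ge0 ?exprn_ge0 ?(ltW c0)// subr_ge0 ler_nat; move: yltx; clear; lia.
Qed.

(** A step divisible by [B] stays in one residue class, so the same branch of [ptilde] applies along
    the whole progression. *)
Lemma ptilde_class (R : realType) (P : {poly R}) (B C : int) (x0 L : nat) : 0 < B ->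
  (B %| L%:Z)%Z -> exists Q : {poly R}, forall t : nat,
    ptilde P B C (x0 + L * t) = Q.[t%:R].
Proof.
move=> B0 BL; have BR : B%:~R != 0 :> R by rewrite intr_eq0 gt_eqF.
have cond t : ((x0 + L * t)%N%:Z == - C %[mod B])%Z = (x0%:Z == - C %[mod B])%Z.
  rewrite !eqz_mod_dvd PoszD PoszM addrAC rpredDr//.
  by rewrite dvdz_mulr.
case: (boolP (x0%:Z == - C %[mod B])%Z) => h.
  exists (P \Po ((L%:R / B%:~R) *: 'X + ((x0%:Z + C)%:~R / B%:~R)%:P)) => t.
  rewrite /ptilde cond h horner_comp !hornerE; congr (P.[_]).
  by rewrite PoszD PoszM !intrD intrM -!pmulrn; field.
by exists 0 => t; rewrite /ptilde cond (negPf h) horner0.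
Qed.

Lemma near_horner_neq0 (R : realType) (Q : {poly R}) : Q != 0 ->
  \forall t \near \oo, Q.[t%:R] != 0.
Proof.
move=> Q0; have [c c0 [U U1 HU]] := poly_abs_lower (polySpred Q0).
apply: (near_mp (nbhs_infty_ger U)); apply: nearW => t tU.
rewrite -normr_gt0; apply: lt_le_trans (HU _ tU).
by rewrite mulr_gt0// exprn_gt0// (lt_le_trans _ tU)// (lt_le_trans _ U1).
Qed.

Lemma cvg_sum_fin (R : realType) (I : finType) (u : I -> nat -> R) (a : I -> R) :
  (forall i, u i @ \oo --> a i) -> (fun N => \sum_i u i N) @ \oo --> \sum_i a i.
Proof.
move=> H; elim: (index_enum I) => [|i s IH].
  rewrite big_nil (_ : (fun _ => _) = fun=> 0); first exact: cvg_cst.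
  by apply/funext => N; rewrite big_nil.
rewrite big_cons (_ : (fun _ => _) = (fun N => u i N + \sum_(j <- s) u j N)).
  exact: cvgD.
by apply/funext => N; rewrite big_cons.
Qed.
End SpacingAny.

(** * Both implications *)

Section Main.
Local Open Scope classical_set_scope.
Local Open Scope ring_scope.

Section CommonForm.
Variables (n : nat) (f : 'I_n -> {poly rat}) (g : {poly rat}) (B C D : 'I_n -> int).
Hypothesis hcf : common_form f g B C D.

Lemma common_form_eval j u :
  g.[(B j)%:~R * u - (C j)%:~R] = (f j + ((D j)%:~R)%:P).[u].
Proof.
have [B0 gE] := hcf j; rewrite gE !hornerD !hornerC horner_comp; congr (_.[_] + _).
rewrite !hornerE subrK mulKf// intr_eq0 gt_eqF//.
Qed.

Lemma common_form_size j : (1 < size (f j))%N -> 0 < lead_coef (f j) ->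
  size g = size (f j) /\ 0 < lead_coef g.
Proof.
move=> sf lf; have [B0 gE] := hcf j.
have BQ : 0 < (B j)%:~R :> rat by rewrite ltr0z.
have BV : (B j)%:~R^-1 != 0 :> rat by rewrite invr_eq0 gt_eqF.
have s2 : size ((B j)%:~R^-1 *: ('X + ((C j)%:~R)%:P) : {poly rat}) = 2.
  by rewrite size_scale// size_XaddC.
have sc : size (f j \Po ((B j)%:~R^-1 *: ('X + ((C j)%:~R)%:P))) = size (f j).
  by rewrite size_comp_poly2.
have sD : (size (((D j)%:~R)%:P : {poly rat}) < size (f j))%N.
  by rewrite (leq_ltn_trans (size_polyC_leq1 _)).
split; first by rewrite gE size_polyDl ?sc.
rewrite gE lead_coefDl ?sc// lead_coef_comp ?s2// lead_coefZ lead_coefXaddC mulr1.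
by rewrite mulr_gt0// exprn_gt0// invr_gt0.
Qed.
End CommonForm.

Lemma horner_nat_bound (R : realType) (P : {poly R}) :
  exists (A : R) (K : nat), 0 <= A /\ forall n : nat, `|P.[n%:R]| <= A * n.+1%:R ^+ K.
Proof.
have [A A0 HA] := poly_bound_ge1 (P \Po ('X - 1)).
exists A, (size (P \Po ('X - 1))); split; first exact: ltW.
move=> n; have := HA (size (P \Po ('X - 1))) n.+1%:R (leqnSn _); rewrite ler1n => /(_ isT).
by rewrite horner_comp !hornerE -natr1 addrK.
Qed.

(* [S] is the series with the exponents [f(n) + D + E0], which are natural
   numbers; [q ^ (D + E0)] converts it back to [qseries]. *)
Lemma qseries_scatter (R : realType) (q : R) (P : {poly R}) (f : {poly rat}) (D : int)
    (E0 : nat) (e : nat -> nat) : 1 < q -> integer_valued f ->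
  (forall n, (0 < n)%N -> (e n)%:R = (f + (D%:~R)%:P).[n%:R] + E0%:R :> rat) ->
  (forall n, (0 < n)%N -> (n <= e n)%N) ->
  exists2 S : R, qseries q P f = q ^ (D + E0%:Z) * S &
    (fun N => \sum_(0 <= k < N) scatter e (fun n => P.[n%:R]) k / q ^+ k) @ \oo --> S.
Proof.
move=> q1 fint eE en; have q0 : 0 < q by apply: lt_trans q1.
have [A [K [A0 HA]]] := horner_nat_bound P.
have [S [S1 S2]] := scatter_series q1 en A0 HA; exists S => //.
have qn : q != 0 by rewrite gt_eqF.
have term n : (0 < n)%N ->
    P.[n%:R] / q `^ ratr f.[n%:R] = q ^ (D + E0%:Z) * (P.[n%:R] / q ^+ e n).
  move=> n0; have /intrP[z zE] := fint n n0.
  have ez : (e n)%:Z = z + (D + E0%:Z).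
    apply/eqP; rewrite -(eqr_int rat) -pmulrn eE// hornerD hornerC zE !intrD -pmulrn.
    by rewrite addrA.
  rewrite zE ratr_int powR_intmul ?(ltW q0)// mulrCA; congr (_ * _).
  rewrite -[q ^+ e n]/(q ^ (e n)%:Z) ez [q ^ (z + _)]expfzDr// invfM mulrCA mulfV ?mulr1//.
  by rewrite expfz_neq0.
rewrite /qseries; apply: cvg_lim => //.
rewrite (_ : (fun _ => _) = (fun N => q ^ (D + E0%:Z) * \sum_(1 <= n < N) P.[n%:R] / q ^+ e n)).
  exact: cvgMr.
apply/funext => N; rewrite mulr_sumr; apply: eq_big_nat => n /andP[n0 _].
exact: term.
Qed.

Unset Implicit Arguments.
Variables (R : realType) (m : nat) (l : 'I_m -> nat).
Variables (f : forall i : 'I_m, 'I_(l i) -> {poly rat}) (g : 'I_m -> {poly rat}).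
Variables (B C D : forall i : 'I_m, 'I_(l i) -> int).
Variables (q : R) (P : forall i : 'I_m, 'I_(l i) -> {poly R}).
Hypothesis hl : forall i, (0 < l i)%N.
Hypothesis f_int : forall i j, integer_valued (f i j).
Hypothesis f_deg : forall i j, (2 < size (f i j))%N.
Hypothesis f_lead : forall i j, 0 < lead_coef (f i j).
Hypothesis f_nsim : forall i1 i2 (j1 : 'I_(l i1)) (j2 : 'I_(l i2)),
  i1 <> i2 -> ~ poly_sim (f i1 j1) (f i2 j2).
Hypothesis hcf : forall i, common_form (f i) (g i) (B i) (C i) (D i).
Hypothesis hq : pisot q \/ salem q.
Hypothesis hP : forall i j k, in_Qadjoin q (P i j)`_k.

Set Implicit Arguments.

Local Notation F i j := (f i j + ((D i j)%:~R)%:P).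

Lemma q_gt1 : 1 < q. Proof. by case: hq => -[]. Qed.
Lemma q_gt0 : 0 < q. Proof. exact: lt_trans q_gt1. Qed.
Lemma q_algint : algebraic_integer q. Proof. by case: hq => -[]. Qed.

Lemma size_common i : (2 < size (g i))%N /\ 0 < lead_coef (g i).
Proof.
have [-> ?] := common_form_size (hcf i) (ltnW (f_deg _ (Ordinal (hl i)))) (f_lead _ _).
by split.
Qed.

Lemma common_nsim i1 i2 : i1 <> i2 -> ~ poly_sim (g i1) (g i2).
Proof.
move=> ne /(common_form_sim (Ordinal (hl i1)) (Ordinal (hl i2)) (hcf i1) (hcf i2)).
exact: f_nsim.
Qed.

Lemma exponents_exist : exists (E0 : nat) (e : forall i, 'I_(l i) -> nat -> nat),
  (forall i j n, (0 < n)%N -> (e i j n)%:R = (F i j).[n%:R] + E0%:R :> rat) /\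
  (forall i j n, (0 < n)%N -> (n <= e i j n)%N).
Proof.
have H (u : {i : 'I_m & 'I_(l i)}) : exists E : nat, forall n : nat,
    n%:R <= (F (tag u) (tagged u)).[n%:R] + E%:R :> rat.
  have sf := f_deg _ (tagged u); have lf := f_lead _ (tagged u).
  have sD : (size (((D _ (tagged u))%:~R)%:P : {poly rat}) < size (f _ (tagged u)))%N.
    by rewrite (leq_ltn_trans (size_polyC_leq1 _))// ltnW.
  apply: (@integer_shift _ (size (f _ (tagged u)) - 3)%N).
    by rewrite size_polyDl// -[LHS](subnKC sf).
  by rewrite lead_coefDl.
have [E HE] := choice H.
pose E0 := (\sum_u E u)%N.
have HE0 i j (n : nat) : n%:R <= (F i j).[n%:R] + E0%:R :> rat.
  apply: le_trans (HE (Tagged (fun i : 'I_m => 'I_(l i)) j) n) _; rewrite lerD2l ler_nat /E0.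
  by rewrite (bigD1 (Tagged (fun i : 'I_m => 'I_(l i)) j))//= leq_addr.
exists E0, (fun i j n => Num.truncn ((F i j).[n%:R] + E0%:R)).
have eF i j n : (0 < n)%N ->
    (Num.truncn ((F i j).[n%:R] + E0%:R))%:R = (F i j).[n%:R] + E0%:R :> rat.
  move=> n0; rewrite truncnK// natrEint (le_trans _ (HE0 i j n))// andbT.
  by rewrite rpredD ?rpred_nat// !hornerE rpredD ?intr_int// f_int.
by split => // i j n n0; rewrite -(ler_nat rat) eF.
Qed.

Unset Implicit Arguments.
Variables (E0 : nat) (e : forall i, 'I_(l i) -> nat -> nat).
Hypothesis eF : forall i j n, (0 < n)%N -> (e i j n)%:R = (F i j).[n%:R] + E0%:R :> rat.
Hypothesis en : forall i j n, (0 < n)%N -> (n <= e i j n)%N.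

Set Implicit Arguments.

Local Notation b i j k := (scatter (e i j) (fun n => (P i j).[n%:R]) k).

Lemma scatter_Qadjoin i j k : in_Qadjoin q (b i j k).
Proof.
by apply: Qadjoin_sum => n; apply: Qadjoin_horner => //; exact: Qadjoin_nat.
Qed.

Lemma near_scatter i : \forall x \near \oo, forall j k, k%:R = (g i).[x%:R] + E0%:R ->
  b i j k = ptilde (P i j) (B i j) (C i j) x.
Proof.
have [sg lg] := size_common i.
apply: filter_forall => j.
have sg' : size (g i) = (size (g i) - 2).+2 by rewrite -[LHS](subnKC (ltnW sg)).
have := @scatter_ptilde R (g i) (F i j) _ (B i j) (C i j) E0 (e i j) sg' lg
  (hcf i j).1 (common_form_eval (hcf i) j) (eF i j) (en i j).
by apply: filterS => x Hx k; exact: Hx.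
Qed.

Lemma support_scatter (X0 : nat) : exists K0 : nat, forall i j k, (K0 <= k)%N ->
  b i j k != 0 -> exists2 x : nat, (X0 <= x)%N & k%:R = (g i).[x%:R] + E0%:R.
Proof.
have H (u : {i : 'I_m & 'I_(l i)}) : exists K0 : nat, forall k, (K0 <= k)%N ->
    b (tag u) (tagged u) k != 0 ->
    exists2 x : nat, (X0 <= x)%N & k%:R = (g (tag u)).[x%:R] + E0%:R.
  have [K0 HK] := @scatter_support R _ _ _ _ E0 (e (tag u) (tagged u)) (hcf _ (tagged u)).1
    (common_form_eval (hcf _) (tagged u)) (eF _ (tagged u)) X0.
  by exists K0 => k; exact: HK.
have [K HK] := choice H; exists (\sum_u K u)%N => i j k Kk.
apply: (HK (Tagged (fun i : 'I_m => 'I_(l i)) j)); apply: leq_trans Kk.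
by rewrite (bigD1 (Tagged (fun i : 'I_m => 'I_(l i)) j))//= leq_addr.
Qed.

Local Notation numbers := (fun u : option {i : 'I_m & 'I_(l i)} =>
  if u is Some (existT i j) then qseries q (P i j) (f i j) else 1).

Lemma sum_option (k : option {i : 'I_m & 'I_(l i)} -> R) :
  \sum_u k u = k None + \sum_(i < m) \sum_(j < l i) k (Some (Tagged (fun i : 'I_m => 'I_(l i)) j)).
Proof.
rewrite (bigD1 None)//=; congr (_ + _); rewrite sig_big_dep /=.
rewrite (reindex_omap Some id) /=; last by case.
by apply: eq_big => [u|[i j] _ //]; rewrite eqxx.
Qed.

(** At large exponents the collected coefficients are values of the [ptilde] at a common x, so the
    relation cancels them. What is left of the combined series is a finite sum in Q(q), which
    becomes minus the coefficient of 1. *)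
Lemma dependent_of_seq_dependent i :
  seq_linearly_dependent q (fun j n => ptilde (P i j) (B i j) (C i j) n) ->
  linearly_dependent q numbers.
Proof.
move=> [k [kQ [j0 kj0] k0]].
have HS0 j : exists S : R, qseries q (P i j) (f i j) = q ^ (D i j + E0%:Z) * S /\
    (fun N => \sum_(0 <= k < N) b i j k / q ^+ k) @ \oo --> S.
  by have [S ? ?] := qseries_scatter (P i j) q_gt1 (f_int i j) (eF i j) (en i j); exists S.
have [S HS] := choice HS0.
have [X0 _ HX0] := near_scatter i.
have [K0 HK0] := support_scatter X0.
have zero n : (K0 <= n)%N -> \sum_j k j * b i j n = 0.
  move=> Kn; have [[j bj]|none] := pselect (exists j, b i j n != 0).
    have [x Xx nE] := HK0 i j n Kn bj.
    by rewrite -[RHS](k0 x); apply: eq_bigr => j' _; rewrite (HX0 x Xx j' n nE).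
  apply: big1 => j _; have [->|bj] := eqVneq (b i j n) 0; first by rewrite mulr0.
  by case: none; exists j.
pose c := \sum_(0 <= n < K0) \sum_j k j * b i j n / q ^+ n.
have cQ : in_Qadjoin q c.
  apply: Qadjoin_sum => n; apply: Qadjoin_sum => j; apply: QadjoinM.
    by apply: QadjoinM => //; exact: scatter_Qadjoin.
  by apply: QadjoinV; apply: QadjoinX; exact: Qadjoin_gen.
have cE : \sum_j k j * S j = c.
  have L1 : (fun N => \sum_j k j * \sum_(0 <= n < N) b i j n / q ^+ n) @ \oo -->
      \sum_j k j * S j.
    by apply: cvg_sum_fin => j; apply: cvgMr; exact: (HS j).2.
  apply: (@cvg_unique _ _ _ _ _ _ L1); first exact: norm_hausdorff.
  apply: (@cvg_trans _ ((fun=> c) @ \oo)); last exact: cvg_cst.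
  apply: near_eq_cvg; exists K0 => // N /= KN; rewrite /c.
  rewrite [RHS](_ : _ = \sum_(0 <= n < N) \sum_j k j * b i j n / q ^+ n).
    rewrite [RHS](big_cat_nat (n := K0))//= [X in _ = _ + X]big_nat_cond.
    rewrite [X in _ = _ + X]big1 ?addr0// => n /andP[/andP[Kn _] _].
    by rewrite -mulr_suml zero// mul0r.
  rewrite exchange_big /=; apply: eq_bigr => j _; rewrite mulr_sumr.
  by apply: eq_bigr => n _; rewrite mulrA.
(* The coefficients of class [i] are extended by 0 to all classes; [dfwith] handles the dependence
   of the index type on the class. *)
pose kp := @dfwith 'I_m (fun i' => 'I_(l i') -> R) (fun i' _ => 0) i k.
have kpi : kp i = k by rewrite /kp dfwithin.
have kpn i' : i' != i -> kp i' = fun=> 0 by move=> ne; rewrite /kp dfwithout// eq_sym.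
have kpQ i' j : in_Qadjoin q (kp i' j).
  have [E|ne] := eqVneq i' i; first by move: j; rewrite E kpi.
  by rewrite kpn//; exact: Qadjoin0.
exists (fun u => if u is Some (existT i' j) then kp i' j * q ^ (- (D i' j + E0%:Z)) else - c).
split.
- case=> [[i' j]|]; last exact: QadjoinN.
  by apply: QadjoinM => //; exact: QadjoinXz.
- exists (Some (Tagged (fun i : 'I_m => 'I_(l i)) j0)); rewrite /= kpi mulf_neq0// expfz_neq0//.
  by rewrite gt_eqF// q_gt0.
- rewrite sum_option /= mulr1 (bigD1 i)//= [X in _ + (_ + X)]big1 => [|i' ne]; last first.
    by apply: big1 => j _; rewrite kpn// !mul0r.
  rewrite addr0 kpi -cE addrC; apply/eqP; rewrite subr_eq0; apply/eqP.
  apply: eq_bigr => j _; rewrite (HS j).1 mulrA -[X in X * S j]mulrA -expfzDr.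
    by rewrite addNr expr0z mulr1.
  by rewrite gt_eqF// q_gt0.
Qed.

Lemma seq_dependent_of_dependent : linearly_dependent q numbers ->
  exists i, seq_linearly_dependent q (fun j n => ptilde (P i j) (B i j) (C i j) n).
Proof.
move=> [k [kQ [u0 ku0] k0]]; apply: contrapT => indep.
have q0 := q_gt0; have qn : q != 0 by rewrite gt_eqF.
(* [kk] absorbs the power of [q] between [qseries] and the series with natural exponents. *)
pose kk i (j : 'I_(l i)) := k (Some (Tagged (fun i : 'I_m => 'I_(l i)) j)) * q ^ (D i j + E0%:Z).
have kkQ i j : in_Qadjoin q (kk i j) by apply: QadjoinM => //; exact: QadjoinXz.
have HS0 (u : {i : 'I_m & 'I_(l i)}) : exists S : R,
    qseries q (P _ (tagged u)) (f _ (tagged u)) = q ^ (D _ (tagged u) + E0%:Z) * S /\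
    (fun N => \sum_(0 <= k < N) b _ (tagged u) k / q ^+ k) @ \oo --> S.
  by have [S ? ?] := qseries_scatter (P _ (tagged u)) q_gt1 (f_int _ (tagged u))
    (eF _ (tagged u)) (en _ (tagged u)); exists S.
have [S0 HS] := choice HS0.
pose S i (j : 'I_(l i)) := S0 (Tagged (fun i : 'I_m => 'I_(l i)) j).
have relation : k None + \sum_(i < m) \sum_(j < l i) kk i j * S i j = 0.
  rewrite -[RHS]k0 sum_option /= mulr1; congr (_ + _).
  apply: eq_bigr => i _; apply: eq_bigr => j _.
  by rewrite (HS (Tagged (fun i : 'I_m => 'I_(l i)) j)).1 mulrA.
pose act i := [exists j, kk i j != 0].
have [i1 act1] : exists i, act i.
  apply: contrapT => none.
  have kkz i j : kk i j = 0.
    by apply: contrapT => /eqP nz; case: none; exists i; apply/existsP; exists j.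
  case: u0 ku0 => [[i j]|] nz.
    by have /eqP := kkz i j; rewrite mulf_eq0 (negPf nz) expfz_eq0 (negPf qn) andbF.
  case/eqP: nz; rewrite -[RHS]relation big1 ?addr0// => i _.
  by apply: big1 => j _; rewrite kkz mul0r.
(* Minimality of the degree matters: with X^4 against X^2 every x would be matched, by y = x^2. *)
case: (@arg_minnP _ i1 act (fun i => size (g i)) act1) => i0 act0 min0.
pose h x := \sum_(j < l i0) kk i0 j * ptilde (P i0 j) (B i0 j) (C i0 j) x.
have [x0 hx0] : exists x0, h x0 != 0.
  apply: contrapT => none; apply: indep; exists i0, (kk i0); split => //.
    by have /existsP := act0.
  by move=> n; apply: contrapT => /eqP nz; apply: none; exists n.
have [sg0 lg0] := size_common i0.
(* The number 1 enters as a series with the single exponent 0. *)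
pose beta n := (if n == 0%N then k None else 0) + \sum_(i < m) \sum_(j < l i) kk i j * b i j n.
have betalim : (fun N => \sum_(0 <= n < N) beta n / q ^+ n) @ \oo --> (0 : R).
  rewrite -[X in _ --> X]relation.
  have L : (fun N => k None + \sum_(i < m) \sum_(j < l i)
      kk i j * \sum_(0 <= n < N) b i j n / q ^+ n) @ \oo -->
      k None + \sum_(i < m) \sum_(j < l i) kk i j * S i j.
    apply: cvgD; first exact: cvg_cst.
    apply: cvg_sum_fin => i; apply: cvg_sum_fin => j; apply: cvgMr.
    exact: (HS (Tagged (fun i : 'I_m => 'I_(l i)) j)).2.
  apply: cvg_trans L; apply: near_eq_cvg; exists 1%N => // N /= N1.
  transitivity (\sum_(0 <= n < N) (if n == 0%N then k None else 0) / q ^+ n +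
    \sum_(0 <= n < N) \sum_(i < m) \sum_(j < l i) kk i j * b i j n / q ^+ n).
    congr (_ + _).
      rewrite big_ltn// eqxx expr0 divr1 big_nat_cond big1 ?addr0// => n.
      by case: n => // n _; rewrite mul0r.
    rewrite exchange_big /=; apply: eq_bigr => i _; rewrite exchange_big /=.
    by apply: eq_bigr => j _; rewrite mulr_sumr; apply: eq_bigr => n _; rewrite mulrA.
  rewrite -big_split /=; apply: eq_bigr => n _; rewrite /beta mulrDl; congr (_ + _).
  by rewrite mulr_suml; apply: eq_bigr => i _; rewrite mulr_suml.
have [Dn Dn0 [[w0 w0E] Dpoly]] : exists2 Dn : int, Dn != 0 &
    (exists w : {poly int}, Dn%:~R * k None = (map_poly intr w).[q]) /\
    forall i j t, exists w : {poly int}, Dn%:~R * (kk i j *: P i j)`_t = (map_poly intr w).[q].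
  have [D1 D10 H1] := Qadjoin_denominator q_algint (kQ None).
  have [||D2 D20 H2] := @common_multiplier {i : 'I_m & 'I_(l i)} (fun u Dn =>
    forall t, exists w : {poly int},
      Dn%:~R * (kk (tag u) (tagged u) *: P (tag u) (tagged u))`_t = (map_poly intr w).[q]).
  - by move=> u D1' D2' H t; apply: integral_multiple.
  - move=> u; apply: Qadjoin_poly_denominator; first exact: q_algint.
    by move=> t; rewrite coefZ; apply: QadjoinM.
  exists (D2 * D1); first exact: mulf_neq0.
  split; first exact: integral_multiple.
  move=> i j t; rewrite [D2 * D1]mulrC; apply: integral_multiple.
  exact: (H2 (Tagged (fun i : 'I_m => 'I_(l i)) j)).
have DnR : Dn%:~R != 0 :> R by rewrite intr_eq0.
pose beta' n := Dn%:~R * beta n.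
have growth : integral_growth q beta'.
  rewrite (_ : beta' = fun n => (if n == 0%N then (map_poly intr w0).[q] else 0) +
    \sum_(i < m) \sum_(j < l i) scatter (e i j)
      (fun n => ((Dn%:~R * kk i j) *: P i j).[n%:R]) n).
    apply: integral_growthD; first exact: integral_growth_dirac (ltW q0).
    apply: integral_growth_sum => i; apply: integral_growth_sum => j.
    apply: integral_growth_scatter; apply: integral_growth_poly (ltW q0) _ => t.
    by have [w wE] := Dpoly i j t; exists w; rewrite -wE !coefZ [RHS]mulrA.
  apply/funext => n; rewrite /beta' /beta mulrDr; congr (_ + _).
    by case: eqP => // _; rewrite mulr0.
  rewrite mulr_sumr; apply: eq_bigr => i _; rewrite mulr_sumr; apply: eq_bigr => j _.
  by rewrite mulrA /scatter mulr_sumr; apply: eq_bigr => n' _; rewrite hornerZ.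
have beta'lim : (fun N => \sum_(0 <= n < N) beta' n / q ^+ n) @ \oo --> (0 : R).
  rewrite -[X in _ --> X](mulr0 (Dn%:~R : R)).
  rewrite [X in X @ _](_ : _ = fun N => Dn%:~R * \sum_(0 <= n < N) beta n / q ^+ n).
    exact: cvgMr.
  by apply/funext => N; rewrite mulr_sumr; apply: eq_bigr => n _; rewrite /beta' mulrA.
have [A [K [A0 isolated]]] := isolated_vanishing hq growth beta'lim.
(* A bad [i] is another class of the relation that may put an exponent into the window around that
   of x. Integrality holds for differences of actual exponents and is what [spacing] requires. *)
pose bad x i := i <> i0 /\ act i /\ exists y w : nat, [/\ (w ^ 2 <= x)%N,
  `|(g i0).[x%:R] - (g i).[y%:R]| <= w%:R & (g i0).[x%:R] - (g i).[y%:R] \is a Num.int].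
have [Y Hgap] := near_gap R sg0 lg0.
have [K0 HK0] := support_scatter Y.
(* Without a bad class the exponent of x is isolated, since [Hgap] keeps the other values of [g i0]
   out of the window; its coefficient is a nonzero multiple of [h x] and would have to vanish. *)
have claim1 : \forall x \near \oo, h x != 0 -> exists i, bad x i.
  have gX : 0 < lead_coef (g i0 - 'X) /\ size (g i0 - 'X) = size (g i0).
    have sX : (size (- 'X : {poly rat}) < size (g i0))%N by rewrite size_polyN size_polyX.
    by rewrite lead_coefDl// size_polyDl.
  have sgX : size (g i0 - 'X) = (size (g i0) - 2).+2.
    by rewrite gX.2 -[LHS](subnKC (ltnW sg0)).
  apply: (near_mp (near_scatter i0)); apply: (near_mp Hgap).
  apply: (near_mp (window_exponential (g i0) E0 K q_gt1 A0)).
  (* Applied to [g i0 - X], this makes the exponent exceed x, hence [w], by more than [K0]: the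
     whole window lies where [HK0] describes the support. *)
  apply: (near_mp (near_poly_gt K0.+1%:R sgX gX.1)).
  apply: (near_mp (nbhs_infty_ge (\sum_j absz (C i0 j)).+1)).
  apply: nearW => x xC xK xw xgap xsc hx.
  have [j pj] : exists j, ptilde (P i0 j) (B i0 j) (C i0 j) x != 0.
    apply: contrapT => none; case/eqP: hx; apply: big1 => j _.
    have [->|nz] := eqVneq (ptilde (P i0 j) (B i0 j) (C i0 j) x) 0; first by rewrite mulr0.
    by case: none; exists j.
  have [n n0 xE] : exists2 n : nat, (0 < n)%N & x%:Z + C i0 j = B i0 j * n%:Z.
    move: pj; rewrite /ptilde eqz_mod_dvd opprK; case: ifP => [/dvdzP[z zE] _|_]; last by rewrite eqxx.
    have Cx : (absz (C i0 j) < x)%N.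
      by apply: leq_ltn_trans xC; rewrite (bigD1 j)//= leq_addr.
    have B0 := (hcf i0 j).1; have z0 : 0 < z by move: B0 zE Cx; clear; nia.
    exists (absz z); first by move: z0; clear; lia.
    by rewrite zE mulrC; congr (_ * _); move: z0; clear; lia.
  pose ee := e i0 j n.
  have eE : ee%:R = (g i0).[x%:R] + E0%:R.
    rewrite eF// -(common_form_eval (hcf i0)); congr (_.[_] + _).
    by rewrite [n%:R]pmulrn -rmorphM /= -xE rmorphD /= addrK -pmulrn.
  have [w hw] := nat_sqrt_exists x; have /andP[hw1 _] := hw.
  have wx : (w <= x)%N.
    by apply: leq_trans hw1; rewrite -mulnn; case: (w) => // w'; rewrite leq_pmulr.
  have eK : (K0 + w < ee)%N.
    rewrite -(ltr_nat rat) eE natrD; move: xK; rewrite hornerD hornerN hornerX -natr1.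
    have : (w%:R : rat) <= x%:R by rewrite ler_nat.
    have : 0 <= E0%:R :> rat by [].
    by lra.
  apply: contrapT => nobad.
  have key i j' k' : (ee - w <= k' <= ee + w)%N -> kk i j' * b i j' k' != 0 -> i = i0 /\ k' = ee.
    move=> kw; rewrite mulf_eq0 negb_or => /andP[kn bn].
    have Kk : (K0 <= k')%N by move: kw eK; clear; lia.
    have [y Yy kE] := HK0 i j' k' Kk bn.
    have dE : (g i0).[x%:R] - (g i).[y%:R] = ee%:R - k'%:R by rewrite eE kE; ring.
    have dw : `|ee%:R - k'%:R| <= w%:R :> rat.
      rewrite ler_norml; apply/andP; split.
        by rewrite lerNl opprB lerBlDl -natrD ler_nat; case/andP: kw.
      by rewrite lerBlDl -natrD ler_nat; move: kw; clear; lia.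
    have [E|ne] := eqVneq i i0; last first.
      case: nobad; exists i; split; first exact/eqP.
      split; first by apply/existsP; exists j'.
      exists y, w; rewrite dE; split => //.
      by rewrite rpredB ?rpred_nat.
    split => //; rewrite E in dE kE.
    have yx : y = x.
      apply: contrapT => ne; have := xgap y w Yy ne hw1.
      by rewrite distrC dE ltNge dw.
    by apply/eqP; rewrite -(eqr_nat rat) kE eE yx.
  have sum0 k' : (ee - w <= k' <= ee + w)%N -> k' <> ee -> beta k' = 0.
    move=> kw ke; rewrite /beta; case: eqP => [k'0|_]; first by move: kw eK; rewrite k'0; clear; lia.
    rewrite add0r big1// => i _; apply: big1 => j' _.
    by apply: contrapT => /eqP nz; have [_] := key i j' k' kw nz.
  have := isolated ee w (xw w ee hw eE); rewrite /beta'.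
  have we : (w < ee)%N by move: eK; clear; lia.
  move=> /(_ we) H; have {}H : Dn%:~R * beta ee = 0.
    by apply: H => k' kw ke; rewrite sum0// mulr0.
  have hE : beta ee = h x.
    rewrite /beta; case: eqP => [e0|_]; first by move: eK; rewrite e0; clear; lia.
    rewrite add0r (bigD1 i0)//= [X in _ + X]big1 ?addr0 => [|i ne].
      by apply: eq_bigr => j' _; rewrite (xsc j' ee eE).
    apply: big1 => j' _; apply: contrapT => /eqP nz.
    have ew : (ee - w <= ee <= ee + w)%N by clear; lia.
    by have [iE _] := key i j' ee ew nz; rewrite iE eqxx in ne.
  by move/eqP: H; rewrite hE mulf_eq0 (negPf DnR) (negPf hx).
(* The shift [s] ranges over a finite type, so one threshold serves for all differences in the
   pigeonhole. *)
have claim2 (L : nat) : (0 < L)%N -> \forall x \near \oo, forall i (s : 'I_m.+1), (0 < s)%N ->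
    bad x i -> bad (x + L * s)%N i -> False.
  move=> L0.
  have sp : \forall x \near \oo, forall (i : 'I_m) (s : 'I_m.+1), i <> i0 -> act i -> (0 < s)%N ->
      forall (y1 y2 w : nat), (w ^ 2 <= 2 * x)%N ->
      `|(g i0).[x%:R] - (g i).[y1%:R]| <= w%:R ->
      `|(g i0).[(x + L * s)%:R] - (g i).[y2%:R]| <= w%:R ->
      (g i0).[x%:R] - (g i).[y1%:R] \is a Num.int -> False.
    apply: filter_forall => i; apply: filter_forall => s.
    have [[ne [ai s0]]|no] := pselect (i <> i0 /\ act i /\ (0 < s)%N); last first.
      by apply: nearW => x ne ai s0; case: no.
    have [sgi lgi] := size_common i.
    have t0 : (0 < L * s)%N by rewrite muln_gt0 L0.
    have ns : ~ poly_sim (g i0) (g i) by apply: common_nsim => E; case: ne.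
    apply: (near_mp (@spacing R _ _ (L * s) sg0 (min0 i ai) lg0 lgi t0 ns)).
    by apply: nearW => x Hx _ _ _; exact: Hx.
  apply: (near_mp sp); apply: (near_mp (nbhs_infty_ge (L * m.+1)%N)); apply: nearW.
  move=> x xL {}sp i s s0 [ne [ai [y1 [w1 [h1 h2 h3]]]]] [_ [_ [y2 [w2 [h4 h5 _]]]]].
  apply: (sp i s ne ai s0 y1 y2 (maxn w1 w2)) => //.
  - have Ls : (L * s <= x)%N by rewrite (leq_trans _ xL)// leq_mul2l ltnW ?orbT.
    by rewrite /maxn; case: ifP => _; move: h1 h4 Ls; clear; lia.
  - by apply: le_trans h2 _; rewrite ler_nat leq_maxl.
  - by apply: le_trans h5 _; rewrite ler_nat leq_maxr.
(* This step is divisible by every [B i0 j], so [h] is a polynomial along x0 + L t; it is nonzero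
   because its value at t = 0 is [h x0]. *)
pose L := (\prod_(j < l i0) absz (B i0 j))%N.
have B0 j : 0 < B i0 j := (hcf i0 j).1.
have L0 : (0 < L)%N by apply: prodn_gt0 => j; move: (B0 j); clear; lia.
have BL j : (B i0 j %| L%:Z)%Z.
  by rewrite dvdzE /= /L (bigD1 j)//= dvdn_mulr.
have HQ j : exists Q : {poly R}, forall t : nat,
    ptilde (P i0 j) (B i0 j) (C i0 j) (x0 + L * t) = Q.[t%:R].
  exact: ptilde_class.
have [Qj HQj] := choice HQ.
pose Q := \sum_(j < l i0) kk i0 j *: Qj j.
have hQ t : h (x0 + L * t)%N = Q.[t%:R].
  by rewrite /Q horner_sum; apply: eq_bigr => j _; rewrite hornerZ -HQj.
have Q0 : Q != 0.
  by apply: contra_neq hx0 => Q0; have := hQ 0%N; rewrite muln0 addn0 Q0 horner0.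
have [N1 _ H1] := claim1; have [N2 _ H2] := claim2 L L0.
have [N3 _ H3] := near_horner_neq0 Q0.
(* [T] passes all three thresholds; the m + 1 points then exceed the number of classes, so two of
   them share a bad class. *)
pose T := (N1 + N2 + N3)%N; pose xs (s : 'I_m.+1) := (x0 + L * (T + s))%N.
have xsT s : (T <= xs s)%N.
  rewrite /xs; apply: leq_trans (leq_addl _ _).
  by rewrite (leq_trans (leq_addr s T))// leq_pmull.
have Hbad s : exists i, bad (xs s) i.
  apply: H1; first by rewrite /= (leq_trans _ (xsT s))// /T -addnA leq_addr.
  rewrite hQ; apply: H3; rewrite /= /T; clear; lia.
have [io Hio] := choice Hbad.
have [s1 [s2 [s12 ioE]]] : exists s1 s2 : 'I_m.+1, (s1 < s2)%N /\ io s1 = io s2.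
  apply: contrapT => none.
  have inj : injective io.
    move=> s1 s2 E; apply/val_inj; case: (ltngtP s1 s2) => // lt; case: none.
      by exists s1, s2.
    by exists s2, s1.
  by have := leq_card io inj; rewrite !card_ord ltnn.
have sm : (s2 - s1 < m.+1)%N by apply: leq_ltn_trans (leq_subr _ _) (ltn_ord s2).
apply: (H2 (xs s1) _ (io s1) (Ordinal sm)) => //=.
- by rewrite (leq_trans _ (xsT s1))// /T; clear; lia.
- by rewrite subn_gt0.
have -> : (xs s1 + L * (s2 - s1) = xs s2)%N.
  rewrite /xs -addnA -mulnDr; congr (_ + L * _)%N; move: s12; clear; lia.
by rewrite ioE.
Qed.

End Main.

Theorem theorem2 (R : realType) (m : nat) (hm : (0 < m)%N)
    (l : 'I_m -> nat) (hl : forall i, (0 < l i)%N)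
    (f : forall i : 'I_m, 'I_(l i) -> {poly rat})
    (f_int : forall i j, integer_valued (f i j))
    (f_deg : forall i j, (2 <= (size (f i j)).-1)%N)
    (f_lead : forall i j, 0 < lead_coef (f i j))
    (f_sim : forall i (j1 j2 : 'I_(l i)), poly_sim (f i j1) (f i j2))
    (f_nsim : forall i1 i2 (j1 : 'I_(l i1)) (j2 : 'I_(l i2)),
      i1 <> i2 -> ~ poly_sim (f i1 j1) (f i2 j2)) :
  (forall i, exists (g : {poly rat}) (B C D : 'I_(l i) -> int),
    common_form (f i) g B C D) /\
  (forall (g : 'I_m -> {poly rat}) (B C D : forall i : 'I_m, 'I_(l i) -> int),
    (forall i, common_form (f i) (g i) (B i) (C i) (D i)) ->
    forall q : R, pisot q \/ salem q ->
    forall P : forall i : 'I_m, 'I_(l i) -> {poly R},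
    (forall i j, P i j <> 0) ->
    (forall i j k, in_Qadjoin q (P i j)`_k /\ algebraic_integer (P i j)`_k) ->
    (linearly_independent q
       (fun u : option {i : 'I_m & 'I_(l i)} =>
          if u is Some (existT i j) then qseries q (P i j) (f i j) else 1)
     <->
     forall i, seq_linearly_independent q
       (fun (j : 'I_(l i)) (n : nat) => ptilde (P i j) (B i j) (C i j) n))).
Proof.
have f_size i j : (2 < size (f i j))%N by have := f_deg i j; lia.
split=> [i|g B C D hcf q hq P _ hP]; first by apply: common_form_exists; [|exact: f_sim].
have PQ i j k : in_Qadjoin q (P i j)`_k := (hP i j k).1.
have [E0 [e [eF en]]] := exponents_exist D f_int f_size f_lead.
split=> [indep i dep|indep dep].
  by apply: indep; exact: (dependent_of_seq_dependent hl f_int f_size f_lead hcf hq PQ eF en dep).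
have [i /indep] := seq_dependent_of_dependent hl f_int f_size f_lead f_nsim hcf hq PQ eF en dep.
by [].
Qed.
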